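(* Let $B\subset\mathcal H$ be bounded, let $T>0$ and $\kappa>0$, and set $R_B=\sup_{u\in B}\|u\|_{\mathcal H}$ and $\tau_\varepsilon^\kappa=\frac{\kappa}{\mu}\varepsilon^2|\log\varepsilon|$ for $0<\varepsilon<1$. There is a constant $C_T$, independent of $\varepsilon$ and $B$, such that for all sufficiently small $\varepsilon>0$ (with $\tau_\varepsilon^\kappa<T$ and $\gamma_\varepsilon\ge8L$), $$\sup_{u_0\in B}\ \sup_{\tau_\varepsilon^\kappa\le t\le T}\bigl\|S_\varepsilon^{\mathcal M}(t-\tau_\varepsilon^\kappa)R_\varepsilon S(\tau_\varepsilon^\kappa)u_0-S(t)u_0\bigr\|_{\mathcal H}\le C_T\bigl(R_B\,\varepsilon^\kappa+d_\varepsilon\bigr).$$ In particular, the bound is $O(\varepsilon^2)$ for $\kappa\ge2$.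
   Context: $\mathcal H$ is an infinite-dimensional real Hilbert space and $A:\mathrm D(A)\subset\mathcal H\to\mathcal H$ is a nonnegative self-adjoint operator with compact resolvent. The map $F:\mathcal H\to\mathcal H$ satisfies, for constants $M,L>0$, $\|F(u)\|_{\mathcal H}\le M$ and $\|F(u)-F(w)\|_{\mathcal H}\le L\|u-w\|_{\mathcal H}$ for all $u,w\in\mathcal H$. Fix $\mu>0$. For $0<\varepsilon\le1$ let $\Lambda_\varepsilon=\mu\varepsilon^{-2}$, $P_\varepsilon=\mathbf 1_{[0,\Lambda_\varepsilon]}(A)$, $Q_\varepsilon=I-P_\varepsilon$, $A_\varepsilon=A+\varepsilon^{-1}Q_\varepsilon$ with $\mathrm D(A_\varepsilon)=\mathrm D(A)$. Put $\beta_\varepsilon=\sup\sigma(A|_{P_\varepsilon\mathcal H})$ ($=0$ if $P_\varepsilon\mathcal H=\{0\}$), $\lambda_\varepsilon^+=\inf\sigma(A|_{Q_\varepsilon\mathcal H})$, $\alpha_\varepsilon=\lambda_\varepsilon^++\varepsilon^{-1}$, $\gamma_\varepsilon=\alpha_\varepsilon-\beta_\varepsilon$ (so $\gamma_\varepsilon\ge\varepsilon^{-1}$). $S(t)$ and $S_\varepsilon(t)$ are the semiflows on $\mathcal H$ of global mild solutions of $\dot v+Av=F(v)$ and $\dot v^\varepsilon+A_\varepsilon v^\varepsilon=F(v^\varepsilon)$, respectively. Whenever $\gamma_\varepsilon\ge8L$, $\mathcal M_\varepsilon=\{p+h_\varepsilon(p):p\in P_\varepsilon\mathcal H\}$ denotes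 the inertial manifold of $S_\varepsilon(t)$ given by classical theory, with $h_\varepsilon:P_\varepsilon\mathcal H\to Q_\varepsilon\mathcal H$, $\|h_\varepsilon\|_{L^\infty}\le M/\alpha_\varepsilon$, $\operatorname{Lip}(h_\varepsilon)\le4L/\gamma_\varepsilon$, $S_\varepsilon(t)\mathcal M_\varepsilon=\mathcal M_\varepsilon$ for $t\ge0$, and dynamics on $\mathcal M_\varepsilon$ governed by $\dot p+Ap=P_\varepsilon F(p+h_\varepsilon(p))$ for $p\in P_\varepsilon\mathcal H$. Write $S_\varepsilon^{\mathcal M}(t)=S_\varepsilon(t)|_{\mathcal M_\varepsilon}$ and define $R_\varepsilon:\mathcal H\to\mathcal M_\varepsilon$, $R_\varepsilon u=P_\varepsilon u+h_\varepsilon(P_\varepsilon u)$. Finally $d_\varepsilon=M/\lambda_\varepsilon^++M/\alpha_\varepsilon\le 2M\varepsilon^2/\mu$. *)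

(* Defs.v *)
From Stdlib Require Import Reals ClassicalEpsilon.
From Coquelicot Require Import Coquelicot.

Local Open Scope R_scope.

Record HilbertSpace := {
  hilbert_carrier :> CompleteNormedModule R_AbsRing;
  inner : hilbert_carrier -> hilbert_carrier -> R;
  inner_sym : forall u v, inner u v = inner v u;
  inner_plus : forall u v w, inner (plus u v) w = inner u w + inner v w;
  inner_scal : forall a u v, inner (scal a u) v = a * inner u v;
  inner_norm : forall u, inner u u = norm u ^ 2
}.

Arguments inner {h} u v.

Definition infinite_dimensional (H : HilbertSpace) : Prop :=
  forall (n : nat) (b : nat -> H),
    exists u : H, forall c : nat -> R,
      u <> sum_n (fun i => scal (c i) (b i)) n.

Definition bounded_set {H : HilbertSpace} (B : H -> Prop) : Prop :=
  exists r : R, forall u, B u -> norm u <= r.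

(* [real m_infty] is 0, so the supremum over the empty set is 0. *)
Definition sup_norm {H : HilbertSpace} (B : H -> Prop) : R :=
  real (Lub_Rbar (fun r => exists u, B u /\ r = norm u)).

(** * Unbounded operators *)

(* The values of [app] outside [dom] are irrelevant. *)
Record operator (H : HilbertSpace) := Operator {
  dom : H -> Prop;
  app : H -> H
}.

Arguments Operator {H} dom app.
Arguments dom {H} o u.
Arguments app {H} o u.

Section Operators.

Context {H : HilbertSpace}.

Implicit Types (A : operator H) (K : H -> Prop).

Definition linear_operator A : Prop :=
  dom A zero /\
  (forall u v, dom A u -> dom A v ->
     dom A (plus u v) /\ app A (plus u v) = plus (app A u) (app A v)) /\
  (forall a u, dom A u ->
     dom A (scal a u) /\ app A (scal a u) = scal a (app A u)).

Definition densely_defined A : Prop :=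
  forall (u : H) (r : R), 0 < r -> exists v, dom A v /\ norm (minus u v) < r.

(* The graph of [A] coincides with the graph of its adjoint. *)
Definition self_adjoint A : Prop :=
  linear_operator A /\ densely_defined A /\
  forall y z : H,
    (forall x, dom A x -> inner (app A x) y = inner x z) <->
    (dom A y /\ app A y = z).

Definition nonnegative A : Prop :=
  forall u, dom A u -> 0 <= inner (app A u) u.

(* [Rl] is the bounded inverse of [A - l : dom A /\ K -> K], where [K] is a
   closed subspace reducing [A]. *)
Definition is_resolvent A K (l : R) (Rl : H -> H) : Prop :=
  (forall u, K u ->
     K (Rl u) /\ dom A (Rl u) /\
     minus (app A (Rl u)) (scal l (Rl u)) = u) /\
  (forall u, K u -> dom A u -> Rl (minus (app A u) (scal l u)) = u) /\
  (exists C : R, forall u, K u -> norm (Rl u) <= C * norm u).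

(* Spectrum of the part of [A] in [K]; only real points are considered, since
   the spectrum of a self-adjoint operator is real. *)
Definition spectrum A K (l : R) : Prop :=
  ~ exists Rl, is_resolvent A K l Rl.

Definition compact_operator (G : H -> H) : Prop :=
  forall x : nat -> H,
    (exists r : R, forall n, norm (x n) <= r) ->
    exists (phi : nat -> nat) (y : H),
      (forall n, (phi n < phi (S n))%nat) /\
      filterlim (fun n => G (x (phi n))) eventually (locally y).

Definition compact_resolvent A : Prop :=
  exists (l : R) (Rl : H -> H),
    is_resolvent A (fun _ => True) l Rl /\ compact_operator Rl.

(** * Functional calculus *)

(* Hilbert basis [b.1] of eigenvectors of [A], with eigenvalues [b.2]. *)
Definition is_eigenbasis A (b : (nat -> H) * (nat -> R)) : Prop :=
  (forall i j : nat, inner (fst b i) (fst b j) = if Nat.eqb i j then 1 else 0) /\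
  (forall n, dom A (fst b n) /\
     app A (fst b n) = scal (snd b n) (fst b n)) /\
  (forall u, is_series (fun n => scal (inner u (fst b n)) (fst b n)) u).

(* When [H] is infinite-dimensional and [A] is self-adjoint with compact
   resolvent, an eigenbasis exists by the spectral theorem. *)
Definition eigenbasis A : (nat -> H) * (nat -> R) :=
  epsilon (inhabits (fun _ => zero, fun _ => 0)) (is_eigenbasis A).

(* [f(A) u = sum_n f(l_n) <u, e_n> e_n]; for bounded [f] this does not depend
   on the eigenbasis. *)
Definition fun_calc A (f : R -> R) (u : H) : H :=
  iota (is_series (fun n =>
    scal (f (snd (eigenbasis A) n) * inner u (fst (eigenbasis A) n))
         (fst (eigenbasis A) n))).

Definition indicator_Icc (a b l : R) : R :=
  if Rle_dec a l then if Rle_dec l b then 1 else 0 else 0.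

(* [exp(-tA)] *)
Definition semigroup A (t : R) : H -> H :=
  fun_calc A (fun l => exp (- t * l)).

(** * Mild solutions *)

Definition continuous_on_half_line (v : R -> H) : Prop :=
  forall t, 0 <= t ->
    filterlim v (within (fun s => 0 <= s) (locally t)) (locally (v t)).

(* [v(t) = exp(-tA) u0 + int_0^t exp(-(t-s)A) F(v(s)) ds] for all [t >= 0]. *)
Definition mild_solution A (F : H -> H) (u0 : H) (v : R -> H) : Prop :=
  continuous_on_half_line v /\
  forall t, 0 <= t ->
    is_RInt (fun s => semigroup A (t - s) (F (v s))) 0 t
            (minus (v t) (semigroup A t u0)).

(* Global mild solutions are unique for Lipschitz [F], so this determines
   [S t] for [t >= 0]. *)
Definition mild_semiflow A (F : H -> H) (S : R -> H -> H) : Prop :=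
  forall u0, mild_solution A F u0 (fun t => S t u0).

(** * Spectral cut-off and the modified operator *)

Definition range (G : H -> H) (u : H) : Prop := exists w, u = G w.

Definition Lambda (mu eps : R) : R := mu / eps ^ 2.

Definition P_ A (mu eps : R) : H -> H :=
  fun_calc A (indicator_Icc 0 (Lambda mu eps)).

Definition Q_ A (mu eps : R) (u : H) : H := minus u (P_ A mu eps u).

Definition A_ A (mu eps : R) : operator H :=
  Operator (dom A) (fun u => plus (app A u) (scal (/ eps) (Q_ A mu eps u))).

(* If [P_ A mu eps] is zero the spectrum is empty and the value is
   [real m_infty], which is 0. *)
Definition beta_ A (mu eps : R) : R :=
  real (Lub_Rbar (spectrum A (range (P_ A mu eps)))).

Definition lambda_plus A (mu eps : R) : R :=
  real (Glb_Rbar (spectrum A (range (Q_ A mu eps)))).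

Definition alpha_ A (mu eps : R) : R := lambda_plus A mu eps + / eps.

Definition gamma_ A (mu eps : R) : R := alpha_ A mu eps - beta_ A mu eps.

Definition d_ A (M mu eps : R) : R :=
  M / lambda_plus A mu eps + M / alpha_ A mu eps.

(** * Inertial manifolds *)

(* [{p + h(p) : p in PH}]; only the values of [h] on [PH] matter. *)
Definition graph_manifold A (mu eps : R) (h : H -> H) (u : H) : Prop :=
  exists p, range (P_ A mu eps) p /\ u = plus p (h p).

(* On the manifold, [S t (p0 + h(p0)) = p(t) + h(p(t))] where [p] solves
   [p' + A p = P F(p + h(p))] with [p(0) = p0]. *)
Definition reduced_dynamics A (F : H -> H) (mu eps : R)
    (S : R -> H -> H) (h : H -> H) : Prop :=
  forall p0, range (P_ A mu eps) p0 ->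
    exists p : R -> H,
      p 0 = p0 /\ continuous_on_half_line p /\
      (forall t, 0 <= t ->
         range (P_ A mu eps) (p t) /\
         S t (plus p0 (h p0)) = plus (p t) (h (p t))) /\
      (forall t, 0 < t ->
         is_derive p t
           (minus (P_ A mu eps (F (plus (p t) (h (p t))))) (app A (p t)))).

Definition attracts_exponentially (S : R -> H -> H) (N : H -> Prop) : Prop :=
  forall u, exists C w : R, 0 < w /\
    forall t, 0 <= t ->
      exists m, N m /\ norm (minus (S t u) m) <= C * exp (- w * t).

Definition is_inertial_manifold A (F : H -> H) (M L mu eps : R)
    (S : R -> H -> H) (h : H -> H) : Prop :=
  let PH := range (P_ A mu eps) in
  let N := graph_manifold A mu eps h in
  (forall p, PH p -> range (Q_ A mu eps) (h p)) /\
  (forall p, PH p -> norm (h p) <= M / alpha_ A mu eps) /\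
  (forall p q, PH p -> PH q ->
     norm (minus (h p) (h q)) <= 4 * L / gamma_ A mu eps * norm (minus p q)) /\
  (forall t, 0 <= t ->
     forall w, N w <-> exists u, N u /\ w = S t u) /\
  reduced_dynamics A F mu eps S h /\
  attracts_exponentially S N.

Definition R_ A (mu eps : R) (h : H -> H) (u : H) : H :=
  plus (P_ A mu eps u) (h (P_ A mu eps u)).

End Operators.

Definition tau_ (kappa mu eps : R) : R :=
  kappa / mu * eps ^ 2 * Rabs (ln eps).

(* Main.v *)
Require Import Defs.
From Stdlib Require Import Reals Lra Lia ClassicalEpsilon.
From Coquelicot Require Import Coquelicot.
From Stdlib Require Import ssreflect.

Local Open Scope general_if_scope.
Local Open Scope R_scope.

Set Bullet Behavior "Strict Subproofs".

(** Expand everything in an orthonormal eigenbasis of [A], obtained from the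
    spectral theorem for the compact resolvent.  Each coordinate of a mild
    solution [v] solves a scalar linear equation.  On the high modes, subtracting
    the free evolution and summing the squares gives
    [|Q v(t)| <= exp(-lambda_plus t) |u0| + M / lambda_plus], and after the time
    [tau] the exponential is at most [eps^kappa].  On the low modes, which are
    finitely many, the difference [z] between the reduced solution and [P v] starts
    from 0 and is driven by [F(p + h p) - F(v)], whose norm is at most
    [L (|z| + |h p| + |Q v|)]; Gronwall's inequality for [|z|^2] concludes. *)

(** * Hilbert spaces and orthonormal sequences *)

(* Coquelicot's sums state their equalities in a canonical structure over [R]. *)
Ltac ring_R :=
  match goal with |- @eq _ ?a ?b => change (@eq R a b) end; ring.

(** The mild solution [v] is never differentiated in H: it is known only through an integral
    formula, and [app A (v t)] would require [v t] to lie in the domain. A single coordinate raises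
    neither problem. Energy estimates are therefore run on partial sums of squared coordinates. For
    the high modes, which are infinitely many, the bound must not depend on the number of terms, and
    then it passes to the norm. For the low modes the partial sum must contain all of them, because
    the Lipschitz estimate of the forcing involves the full norm of [z]. The linear part only helps
    there, its rates being nonnegative, so the growth constant depends on [L] and [T] alone.
    [semigroup], [P_] and [Q_] are defined through a basis picked by [epsilon] and a sum picked by
    [iota]; hence a spectral theorem has to precede every coordinate formula, and all later facts
    must hold for whichever eigenbasis was picked. *)

Lemma Rlt_of_sqr (x y : R) : 0 <= y -> x ^ 2 < y ^ 2 -> x < y.
Proof. intros. nra. Qed.

Lemma Rle_of_sqr (x y : R) : 0 <= y -> x ^ 2 <= y ^ 2 -> x <= y.
Proof. intros. nra. Qed.

Section Hilbert.

Context {H : HilbertSpace}.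

Implicit Types (u v w : H) (a : R).

Lemma inner_plus_r u v w : inner u (plus v w) = inner u v + inner u w.
Proof. rewrite inner_sym inner_plus (inner_sym _ v) (inner_sym _ w). reflexivity. Qed.

Lemma inner_scal_r a u v : inner u (scal a v) = a * inner u v.
Proof. rewrite inner_sym inner_scal inner_sym. reflexivity. Qed.

Lemma inner_opp u v : inner (opp u) v = - inner u v.
Proof.
  replace (opp u) with (scal (opp one) u) by exact (scal_opp_one u).
  rewrite inner_scal. unfold opp, one; simpl. ring.
Qed.

Lemma inner_opp_r u v : inner u (opp v) = - inner u v.
Proof. rewrite inner_sym inner_opp inner_sym. reflexivity. Qed.

Lemma inner_minus u v w : inner (minus u v) w = inner u w - inner v w.
Proof. unfold minus. rewrite inner_plus inner_opp. ring. Qed.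

Lemma inner_minus_r u v w : inner u (minus v w) = inner u v - inner u w.
Proof. unfold minus. rewrite inner_plus_r inner_opp_r. ring. Qed.

Lemma inner_zero v : inner zero v = 0.
Proof.
  replace (zero : H) with (scal zero v) by exact (scal_zero_l v).
  rewrite inner_scal. unfold zero; simpl. ring.
Qed.

Lemma inner_zero_r v : inner v zero = 0.
Proof. rewrite inner_sym. apply inner_zero. Qed.

Lemma inner_ge0 u : 0 <= inner u u.
Proof. rewrite inner_norm. apply pow2_ge_0. Qed.

Lemma inner_eq0 u : inner u u = 0 -> u = zero.
Proof. rewrite inner_norm. intros E. apply (norm_eq_zero (V := H) u). nra. Qed.

Lemma eq_of_inner u v : (forall w, inner u w = inner v w) -> u = v.
Proof.
  intros E.
  assert (D : minus u v = zero).
  { apply inner_eq0. rewrite inner_minus E. ring. }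
  exact (plus_reg_r (G := H) (opp v) u v (eq_trans D (eq_sym (plus_opp_r (G := H) v)))).
Qed.

Lemma cauchy_schwarz u v : Rabs (inner u v) <= norm u * norm v.
Proof.
  pose proof (norm_ge_0 u). pose proof (norm_ge_0 v).
  destruct (Req_dec (norm v) 0) as [Z|NZ].
  { rewrite (norm_eq_zero (V := H) v Z) inner_zero_r Rabs_R0 norm_zero. lra. }
  (* The squared norm of |v|^2 u - <u,v> v is |v|^2 (|u|^2 |v|^2 - <u,v>^2); this multiple of the
     projection residual avoids division. *)
  pose proof (inner_ge0 (minus (scal (inner v v) u) (scal (inner u v) v))) as P.
  rewrite !inner_minus !inner_minus_r !inner_scal !inner_scal_r in P.
  rewrite (inner_sym _ v u) !inner_norm in P.
  assert (I : (inner u v) ^ 2 <= (norm u * norm v) ^ 2).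
  { apply Rmult_le_reg_l with (norm v ^ 2); [|nra]. nra. }
  rewrite -(Rabs_pos_eq (norm u * norm v)); [|nra].
  apply Rsqr_le_abs_0. unfold Rsqr. nra.
Qed.

Lemma is_linear_inner v : is_linear (fun u : H => inner u v : R).
Proof.
  split.
  - intros; apply inner_plus.
  - intros; apply inner_scal.
  - exists (norm v + 1). pose proof (norm_ge_0 v). split; [lra|].
    intros u. eapply Rle_trans; [apply (cauchy_schwarz u v)|].
    pose proof (norm_ge_0 u). nra.
Qed.

Lemma filterlim_inner {T} (F : (T -> Prop) -> Prop) (f : T -> H) u v :
  filterlim f F (locally u) ->
  filterlim (fun t => inner (f t) v) F (locally (inner u v)).
Proof.
  intros L. apply (filterlim_comp _ _ _ f (fun u : H => inner u v) F (locally u)).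
  - exact L.
  - exact (linear_cont (V := R_NormedModule) (fun u : H => inner u v) u (is_linear_inner v)).
Qed.

Lemma norm_scal_eq a u : norm (scal a u) = Rabs a * norm u.
Proof.
  pose proof (norm_ge_0 u). pose proof (norm_ge_0 (scal a u)). pose proof (Rabs_pos a).
  apply Rsqr_inj; [assumption|nra|].
  pose proof (inner_norm _ (scal a u)) as N.
  rewrite inner_scal inner_scal_r inner_norm in N.
  unfold Rsqr.
  assert (a * a = Rabs a * Rabs a) by (apply (Rsqr_abs a)). nra.
Qed.

Lemma norm_minus_sym u v : norm (minus u v) = norm (minus v u).
Proof. rewrite -(norm_opp (minus u v)) opp_minus. reflexivity. Qed.

Lemma norm_minus_eq0 u v : norm (minus u v) = 0 -> u = v.
Proof.
  intros E. apply (norm_eq_zero (V := H)) in E. apply eq_of_inner. intros w.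
  apply Rminus_diag_uniq. rewrite -inner_minus E. apply inner_zero.
Qed.

Lemma norm_le_of_inner u C : 0 <= C -> inner u u <= C ^ 2 -> norm u <= C.
Proof. intros C0 I. rewrite inner_norm in I. pose proof (norm_ge_0 u). nra. Qed.

Lemma filterlim_norm_minus {T} (F : (T -> Prop) -> Prop) {FF : Filter F} (f : T -> H) u :
  filterlim f F (locally u) <->
  (forall eps : posreal, F (fun t => norm (minus (f t) u) < eps)).
Proof. exact (filterlim_locally_ball_norm f u). Qed.

Lemma inner_sum_n_m (b : nat -> H) v n m :
  inner (sum_n_m b n m) v = sum_n_m (fun i => inner (b i) v) n m.
Proof.
  induction m as [|m IH].
  - destruct n.
    + rewrite !sum_n_n. reflexivity.
    + rewrite !sum_n_m_zero; try lia. apply inner_zero.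
  - destruct (Nat.le_gt_cases n (S m)) as [I|I].
    + rewrite !sum_n_Sm; try lia. rewrite inner_plus IH. reflexivity.
    + rewrite !sum_n_m_zero; try lia. apply inner_zero.
Qed.

Lemma inner_sum_n (b : nat -> H) v N :
  inner (sum_n b N) v = sum_n (fun i => inner (b i) v) N.
Proof. apply inner_sum_n_m. Qed.

End Hilbert.

(* Vector identities are checked after pairing with an arbitrary vector. *)
Ltac vec :=
  apply eq_of_inner; intro;
  rewrite ?(inner_minus, inner_plus, inner_scal, inner_opp, inner_zero).

Lemma ex_series_of_nonneg_bounded (a : nat -> R) (C : R) :
  (forall n, 0 <= a n) -> (forall N, sum_n a N <= C) -> ex_series a.
Proof.
  intros P B.
  destruct (ex_finite_lim_seq_incr (sum_n a) C) as [l Hl].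
  - intros n. rewrite sum_Sn. unfold plus; simpl. pose proof (P (S n)). lra.
  - exact B.
  - exists l. exact Hl.
Qed.

Lemma sum_n_le (a b : nat -> R) N :
  (forall n, a n <= b n) -> sum_n a N <= sum_n b N.
Proof. intros I. apply sum_n_m_le. exact I. Qed.

Lemma sum_n_nonneg (a : nat -> R) N : (forall n, 0 <= a n) -> 0 <= sum_n a N.
Proof.
  intros I. apply Rle_trans with (sum_n (fun _ => 0) N); [|apply sum_n_le; exact I].
  rewrite sum_n_const. lra.
Qed.

(** * Bessel's inequality and Riesz-Fischer for an orthonormal sequence *)

Section Orthonormal.

Context {H : HilbertSpace}.

Variable e : nat -> H.
Hypothesis ortho : forall i j, inner (e i) (e j) = if Nat.eqb i j then 1 else 0.

Implicit Types (u v : H) (c : nat -> R).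

Lemma inner_expansion_out c n m k : (k < n \/ m < k)%nat ->
  inner (sum_n_m (fun i => scal (c i) (e i)) n m) (e k) = 0.
Proof.
  intros K. rewrite inner_sum_n_m.
  rewrite (sum_n_m_ext_loc _ (fun _ => 0)).
  - apply (sum_n_m_const_zero (G := R_AbelianMonoid)).
  - intros i Hi. rewrite inner_scal ortho.
    destruct (Nat.eqb_spec i k); [lia|exact (Rmult_0_r _)].
Qed.

Lemma inner_expansion c N k : (k <= N)%nat ->
  inner (sum_n (fun i => scal (c i) (e i)) N) (e k) = c k.
Proof.
  intros K. induction N as [|N IH].
  - assert (k = 0)%nat by lia. subst k.
    rewrite sum_O inner_scal ortho. simpl. ring.
  - rewrite sum_Sn inner_plus inner_scal ortho.
    destruct (Nat.eqb_spec (S N) k) as [E|E].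
    + subst k. unfold sum_n. rewrite inner_expansion_out; try lia. ring.
    + rewrite IH; try lia. ring.
Qed.

Lemma inner_expansion_self c n m :
  inner (sum_n_m (fun i => scal (c i) (e i)) n m)
        (sum_n_m (fun i => scal (c i) (e i)) n m) = sum_n_m (fun i => c i ^ 2) n m.
Proof.
  induction m as [|m IH].
  - destruct n.
    + rewrite !sum_n_n inner_scal inner_scal_r ortho. simpl. ring.
    + rewrite !sum_n_m_zero; try lia. apply inner_zero.
  - destruct (Nat.le_gt_cases n (S m)) as [I|I].
    + rewrite !sum_n_Sm; try lia.
      rewrite inner_plus !inner_plus_r IH (inner_sym _ (scal _ _) (sum_n_m _ _ _)).
      rewrite !inner_scal_r inner_scal inner_expansion_out; try lia. rewrite ortho Nat.eqb_refl.
      unfold plus; simpl. ring.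
    + rewrite !sum_n_m_zero; try lia. apply inner_zero.
Qed.

Lemma bessel u N : sum_n (fun i => inner u (e i) ^ 2) N <= norm u ^ 2.
Proof.
  set (s := sum_n (fun i => scal (inner u (e i)) (e i)) N).
  assert (E1 : inner s s = sum_n (fun i => inner u (e i) ^ 2) N)
    by apply inner_expansion_self.
  assert (E2 : inner s u = sum_n (fun i => inner u (e i) ^ 2) N).
  { unfold s. rewrite inner_sum_n. apply sum_n_ext. intros i.
    rewrite inner_scal (inner_sym _ (e i)). ring_R. }
  pose proof (inner_ge0 (minus u s)) as P.
  rewrite inner_minus !inner_minus_r (inner_sym _ u s) E1 E2 inner_norm in P. lra.
Qed.

(** By orthonormality the squared norm of a block of the series is a block of the convergent series
    of squares, so the partial sums are Cauchy and completeness of H applies. *)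
Lemma riesz_fischer c (C : R) :
  (forall N, sum_n (fun i => c i ^ 2) N <= C) ->
  ex_series (fun i => scal (c i) (e i)).
Proof.
  intros B. apply ex_series_Cauchy. intros eps.
  assert (X : ex_series (fun i => c i ^ 2)).
  { apply ex_series_of_nonneg_bounded with C; [intros; apply pow2_ge_0|exact B]. }
  apply (Cauchy_ex_series (V := R_CompleteNormedModule)) in X.
  assert (P : 0 < eps ^ 2) by (apply pow_lt, cond_pos).
  destruct (X (mkposreal _ P)) as [N HN]. exists N. intros n m Hn Hm.
  assert (A : norm (sum_n_m (fun i => scal (c i) (e i)) n m) ^ 2 < eps ^ 2).
  { rewrite -inner_norm inner_expansion_self.
    eapply Rle_lt_trans; [apply Rle_abs|exact (HN n m Hn Hm)]. }
  apply Rlt_of_sqr; [left; apply cond_pos|exact A].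
Qed.

(** Pairing with [e k] is continuous, and the [k]-th coordinate of the partial sums is constant from
    index [k] on. *)
Lemma inner_series c v k :
  is_series (fun i => scal (c i) (e i)) v -> inner v (e k) = c k.
Proof.
  intros S. apply (filterlim_inner _ _ _ (e k)) in S.
  eapply (filterlim_locally_unique (F := eventually)); [exact S|].
  apply filterlim_ext_loc with (fun _ => c k); [|apply filterlim_const].
  exists k. intros n Hn. symmetry. apply inner_expansion. exact Hn.
Qed.

(** This is how estimates on finitely many coordinates, uniform in their number, reach the norm of
    H. *)
Lemma norm_series_le c v (C : R) : 0 <= C ->
  (forall N, sum_n (fun i => c i ^ 2) N <= C ^ 2) ->
  is_series (fun i => scal (c i) (e i)) v -> norm v <= C.
Proof.
  intros C0 B S.
  assert (L : is_lim_seq (fun N => norm (sum_n (fun i => scal (c i) (e i)) N)) (norm v)).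
  { unfold is_lim_seq. simpl. eapply filterlim_comp; [exact S|apply filterlim_norm]. }
  assert (X : Rbar_le (norm v) C).
  { eapply is_lim_seq_le; [|exact L|apply is_lim_seq_const].
    intros N. apply norm_le_of_inner; [assumption|].
    eapply Rle_trans; [|apply (B N)]. right. apply inner_expansion_self. }
  exact X.
Qed.

End Orthonormal.

(** * Compact symmetric operators *)

Section CompactSymmetric.

Context {H : HilbertSpace}.

Variable G : H -> H.
Hypothesis G_plus : forall u v, G (plus u v) = plus (G u) (G v).
Hypothesis G_scal : forall (a : R) u, G (scal a u) = scal a (G u).
Hypothesis G_bounded : exists C, forall u, norm (G u) <= C * norm u.
Hypothesis G_sym : forall u v, inner (G u) v = inner u (G v).
Hypothesis G_compact : compact_operator G.
Hypothesis G_injective : forall u, G u = zero -> u = zero.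

Implicit Types (u v : H).

Lemma filterlim_bounded_linear (x : nat -> H) u :
  filterlim x eventually (locally u) ->
  filterlim (fun n => G (x n)) eventually (locally (G u)).
Proof.
  intros L. apply (filterlim_comp _ _ _ x G eventually (locally u)); [exact L|].
  apply (linear_cont (U := H) (V := H) G u). split.
  - exact G_plus.
  - exact G_scal.
  - destruct G_bounded as [C HC]. exists (Rabs C + 1).
    pose proof (Rabs_pos C). split; [lra|]. intros v.
    eapply Rle_trans; [apply HC|]. pose proof (norm_ge_0 v). pose proof (Rle_abs C).
    apply Rmult_le_compat_r; [assumption|lra].
Qed.

(* [x] is a maximizing sequence for [norm (G u)] on the unit sphere of [V];
   the residual [G (G x) - K^2 x] is small by symmetry. *)
Lemma maximizer_eigenvector_sqr (V : H -> Prop) (K : R) (x : nat -> H) : 0 < K ->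
  (forall u, V u -> V (G u)) ->
  (forall u, V u -> norm (G u) <= K * norm u) ->
  (forall n, V (x n) /\ norm (x n) = 1 /\
     K ^ 2 - norm (G (x n)) ^ 2 <= (/ INR (S n)) ^ 2) ->
  exists (phi : nat -> nat) (z : H), filterlim (fun n => x (phi n)) eventually (locally z) /\
    G (G z) = scal (K ^ 2) z.
Proof.
  intros K0 VG VK Hx.
  destruct (G_compact x) as (phi & y & Hphi & L).
  { exists 1. intros n. right. apply Hx. }
  assert (phi_ge : forall n, (n <= phi n)%nat).
  { induction n as [|n IH]; [lia|]. pose proof (Hphi n). lia. }
  set (r := fun n => (minus (G (G (x (phi n)))) (scal (K ^ 2) (x (phi n))) : H)).
  (* Expanding the square and using symmetry, |GGx - K^2 x|^2 = |GGx|^2 - 2 K^2 |Gx|^2 + K^4, and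
     |GGx| <= K |Gx| bounds it by K^2 (K^2 - |Gx|^2). *)
  assert (Hr : forall n, norm (r n) <= K * / INR (S n)).
  { intros n. destruct (Hx (phi n)) as (Vx & N1 & D).
    assert (I1 : / INR (S (phi n)) <= / INR (S n)).
    { apply Rinv_le_contravar; [apply lt_0_INR; lia|apply le_INR].
      pose proof (phi_ge n). lia. }
    assert (I0 : 0 < / INR (S (phi n))).
    { apply Rinv_0_lt_compat, lt_0_INR. lia. }
    pose proof (VK _ (VG _ Vx)) as I2.
    apply norm_le_of_inner; [nra|].
    unfold r. rewrite !inner_minus !inner_minus_r !inner_scal !inner_scal_r.
    rewrite (inner_sym _ _ (G (G (x (phi n))))) (G_sym (G _) (x (phi n))).
    rewrite !inner_norm N1.
    pose proof (norm_ge_0 (G (G (x (phi n))))).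
    assert (norm (G (G (x (phi n)))) ^ 2 <= (K * norm (G (x (phi n)))) ^ 2)
      by (apply pow_incr; split; [apply norm_ge_0|exact I2]).
    assert ((/ INR (S (phi n))) ^ 2 <= (/ INR (S n)) ^ 2)
      by (apply pow_incr; lra).
    assert (K ^ 2 * (K ^ 2 - norm (G (x (phi n))) ^ 2) <= K ^ 2 * (/ INR (S n)) ^ 2)
      by (apply Rmult_le_compat_l; [nra|lra]).
    nra. }
  assert (Lr : filterlim r eventually (locally (zero : H))).
  { apply filterlim_norm_minus; [apply eventually_filter|]. intros eps.
    destruct (archimed_cor1 (eps / K)) as (N & HN & N0).
    { apply Rdiv_lt_0_compat; [apply cond_pos|exact K0]. }
    exists N. intros n Hn.
    rewrite (_ : minus (r n) zero = r n); [|vec; ring].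
    eapply Rle_lt_trans; [apply Hr|].
    assert (/ INR (S n) <= / INR N).
    { apply Rinv_le_contravar; [apply lt_0_INR; lia|apply le_INR; lia]. }
    apply Rle_lt_trans with (K * / INR N); [nra|].
    apply Rlt_le_trans with (K * (eps / K)); [nra|]. right. field. lra. }
  (* Compactness gives convergence of [G (x (phi n))] only. Solving the residual for [x (phi n)]
     expresses it by [G (G (x (phi n)))] and a null sequence, so the maximizing subsequence itself
     converges. *)
  set (z := scal (/ K ^ 2) (G y)).
  assert (Lz : filterlim (fun n => x (phi n)) eventually (locally z)).
  { apply filterlim_ext with
      (fun n => scal (/ K ^ 2) (plus (G (G (x (phi n)))) (scal (-1) (r n)))).
    { intros n. unfold r. vec. field. lra. }
    rewrite (_ : z = scal (/ K ^ 2) (plus (G y) (scal (-1) zero))); [|unfold z; vec; ring].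
    eapply filterlim_comp; [|apply (filterlim_scal_r (V := H))].
    eapply filterlim_comp_2; [| |apply (filterlim_plus (V := H))].
    - apply filterlim_bounded_linear. exact L.
    - eapply filterlim_comp; [exact Lr|apply (filterlim_scal_r (V := H))]. }
  exists phi, z. split; [exact Lz|].
  assert (Ez : G z = y).
  { apply (filterlim_locally_unique (F := eventually) (V := H) (fun n => G (x (phi n)))).
    - apply filterlim_bounded_linear. exact Lz.
    - exact L. }
  rewrite Ez. unfold z. vec. field. lra.
Qed.

(** With K the norm of [G] on the closed invariant subspace [V], a limit of maximizers satisfies (G
    - K)(G + K) z = 0. Either (G + K) z vanishes and [z] has eigenvalue -K, or (G + K) z is an
    eigenvector for K. In both cases the absolute value of the eigenvalue is the norm of [G] on
    [V]. *)
Lemma exists_eigenvector (V : H -> Prop) (u0 : H) :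
  (forall u v, V u -> V v -> V (plus u v)) ->
  (forall a u, V u -> V (scal a u)) ->
  (forall (x : nat -> H) u, (forall n, V (x n)) ->
     filterlim x eventually (locally u) -> V u) ->
  (forall u, V u -> V (G u)) -> V u0 -> u0 <> zero ->
  exists e m, V e /\ norm e = 1 /\ G e = scal m e /\
    forall u, V u -> norm (G u) <= Rabs m * norm u.
Proof.
  intros Vp Vs Vc VG Vu0 u0n.
  assert (unit : forall u, u <> zero -> norm (scal (/ norm u) u) = 1 /\ 0 < norm u).
  { intros u Hu.
    assert (0 < norm u).
    { destruct (Rle_lt_or_eq_dec 0 (norm u) (norm_ge_0 u)) as [|E]; [assumption|].
      exfalso. apply Hu, (norm_eq_zero (V := H)). symmetry. exact E. }
    split; [|assumption].
    rewrite norm_scal_eq Rabs_pos_eq; [|left; apply Rinv_0_lt_compat; assumption].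
    field. lra. }
  destruct G_bounded as [C HC].
  set (E := fun r => exists u, V u /\ norm u = 1 /\ r = norm (G u)).
  destruct (completeness E) as [K [Kub Klub]].
  { exists C. intros r (u & _ & N & ->). pose proof (HC u) as I. rewrite N in I. lra. }
  { exists (norm (G (scal (/ norm u0) u0))). exists (scal (/ norm u0) u0).
    split; [apply Vs, Vu0|]. split; [apply unit, u0n|reflexivity]. }
  assert (VK : forall u, V u -> norm (G u) <= K * norm u).
  { intros u Vu. destruct (classic (u = zero)) as [->|Hu].
    - rewrite (_ : zero = scal 0 (zero : H)); [|vec; ring].
      rewrite G_scal !norm_scal_eq Rabs_R0. lra.
    - destruct (unit u Hu) as [N1 N0].
      assert (I : norm (G (scal (/ norm u) u)) <= K).
      { apply Kub. exists (scal (/ norm u) u). auto. }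
      rewrite G_scal norm_scal_eq Rabs_pos_eq in I; [|left; apply Rinv_0_lt_compat; assumption].
      apply Rmult_le_compat_r with (r := norm u) in I; [|lra].
      replace (/ norm u * norm (G u) * norm u) with (norm (G u)) in I by (field; lra).
      exact I. }
  assert (K0 : 0 < K).
  { destruct (unit u0 u0n) as [_ N0].
    destruct (unit (G u0)) as [_ N1]; [intros Z; apply u0n, G_injective, Z|].
    pose proof (VK u0 Vu0). nra. }
  assert (ex : forall n, exists u, V u /\ norm u = 1 /\
     K ^ 2 - norm (G u) ^ 2 <= (/ INR (S n)) ^ 2).
  { intros n.
    assert (P : 0 < / INR (S n)) by (apply Rinv_0_lt_compat, lt_0_INR; lia).
    apply NNPP. intros N.
    (* If no unit vector were that close to maximal, this square root would be an upper bound
       smaller than the supremum K. The [Rmax 0] covers a negative radicand, where positivity of K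
       gives the contradiction. *)
    assert (Q : K <= sqrt (Rmax 0 (K ^ 2 - (/ INR (S n)) ^ 2))).
    { apply Klub. intros r (u & Vu & N1 & ->).
      apply Rle_of_sqr; [apply sqrt_pos|]. rewrite pow2_sqrt; [|apply Rmax_l].
      eapply Rle_trans; [|apply Rmax_r].
      apply Rnot_lt_le. intros I. apply N. exists u. repeat split; [assumption..|lra]. }
    assert (Q2 : K ^ 2 <= sqrt (Rmax 0 (K ^ 2 - (/ INR (S n)) ^ 2)) ^ 2)
      by (apply pow_incr; lra).
    rewrite pow2_sqrt in Q2; [|apply Rmax_l].
    revert Q2. apply Rmax_case; intros; nra. }
  set (x := fun n => proj1_sig (constructive_indefinite_description _ (ex n))).
  assert (Hx : forall n, V (x n) /\ norm (x n) = 1 /\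
     K ^ 2 - norm (G (x n)) ^ 2 <= (/ INR (S n)) ^ 2)
    by (intros n; exact (proj2_sig (constructive_indefinite_description _ (ex n)))).
  destruct (maximizer_eigenvector_sqr V K x K0 VG VK Hx) as (phi & z & Lz & Ez).
  assert (Vz : V z) by (eapply Vc; [|exact Lz]; intros n; apply Hx).
  assert (Nz : norm z = 1).
  { symmetry. apply (filterlim_locally_unique (F := eventually) (V := R_NormedModule)
      (fun n => norm (x (phi n)))).
    - apply filterlim_ext with (fun _ => 1); [|apply filterlim_const].
      intros n. symmetry. apply Hx.
    - eapply filterlim_comp; [exact Lz|apply (filterlim_norm (V := H))]. }
  set (w := plus (G z) (scal K z)).
  destruct (classic (w = zero)) as [Zw|Nw].
  - exists z, (- K). repeat split; [assumption..| |].
    + apply (plus_reg_r (G := H) (scal K z)). transitivity w; [reflexivity|].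
      rewrite Zw. vec. ring.
    + rewrite Rabs_Ropp (Rabs_pos_eq K); [|lra]. exact VK.
  - exists (scal (/ norm w) w), K. repeat split.
    + apply Vs, Vp; [apply VG|apply Vs]; exact Vz.
    + apply unit, Nw.
    + unfold w. rewrite G_scal G_plus G_scal Ez. vec. ring.
    + rewrite (Rabs_pos_eq K); [|lra]. exact VK.
Qed.

(** If infinitely many eigenvalues had modulus at least [c], their images under [G] would be at
    mutual distance at least [c], since |G e_a - G e_b|^2 = m_a^2 + m_b^2, and no subsequence could
    converge. *)
Lemma eigenvalues_tend_to_0 (e : nat -> H) (m : nat -> R) (c : R) :
  (forall i j, inner (e i) (e j) = if Nat.eqb i j then 1 else 0) ->
  (forall n, G (e n) = scal (m n) (e n)) -> 0 < c ->
  exists N, forall n, (N <= n)%nat -> Rabs (m n) < c.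
Proof.
  intros ortho Ge c0. apply NNPP. intros X.
  assert (ex : forall n, exists k, (n <= k)%nat /\ c <= Rabs (m k)).
  { intros n. apply NNPP. intros Y. apply X. exists n. intros k Hk.
    apply Rnot_le_lt. intros I. apply Y. exists k. auto. }
  set (k := fun n => proj1_sig (constructive_indefinite_description _ (ex n))).
  assert (Hk : forall n, (n <= k n)%nat /\ c <= Rabs (m (k n)))
    by (intros n; exact (proj2_sig (constructive_indefinite_description _ (ex n)))).
  destruct (G_compact (fun n => e (k n))) as (phi & y & Hphi & L).
  { exists 1. intros n. apply norm_le_of_inner; [lra|]. rewrite ortho Nat.eqb_refl. lra. }
  assert (phi_ge : forall n, (n <= phi n)%nat).
  { induction n as [|n IH]; [lia|]. pose proof (Hphi n). lia. }
  pose proof (proj1 (filterlim_norm_minus eventually _ y) L) as Ly.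
  assert (P : 0 < c / 2) by lra.
  destruct (Ly (mkposreal _ P)) as [N HN]. simpl in HN.
  (* [k] may repeat values, so [j] is pushed beyond [k (phi N)]: then k (phi j) >= phi j >= j > k
     (phi N), and the two eigenvectors are distinct. *)
  set (j := (N + S (k (phi N)))%nat).
  assert (d : k (phi N) <> k (phi j)).
  { pose proof (phi_ge j). pose proof (proj1 (Hk (phi j))). unfold j in *. lia. }
  set (a := k (phi N)) in *. set (b := k (phi j)) in *.
  assert (I : norm (minus (G (e a)) (G (e b))) < c).
  { rewrite (_ : minus (G (e a)) (G (e b)) =
      plus (minus (G (e a)) y) (minus y (G (e b)))); [|vec; ring].
    eapply Rle_lt_trans; [apply (norm_triangle (V := H))|].
    rewrite (norm_minus_sym y).
    assert (norm (minus (G (e a)) y) < c / 2) by (apply HN; lia).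
    assert (norm (minus (G (e b)) y) < c / 2) by (apply HN; unfold j; lia).
    lra. }
  assert (J : c ^ 2 <= norm (minus (G (e a)) (G (e b))) ^ 2).
  { rewrite -inner_norm !Ge !inner_minus !inner_minus_r !inner_scal !inner_scal_r !ortho.
    rewrite !Nat.eqb_refl. destruct (Nat.eqb_spec a b); [contradiction|].
    destruct (Nat.eqb_spec b a); [congruence|].
    assert (c ^ 2 <= m a ^ 2) by (rewrite -(pow2_abs (m a)); apply pow_incr; split; [lra|apply Hk]).
    pose proof (pow2_ge_0 (m b)). nra. }
  pose proof (norm_ge_0 (minus (G (e a)) (G (e b)))). nra.
Qed.

(** * Inductive construction of the eigenbasis of a compact symmetric operator *)

Hypothesis H_inf : infinite_dimensional H.

(** Maximality on the orthogonal complement is recorded along with the eigenvector equation, because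
    completeness of the resulting sequence rests on it. *)
Definition next_eigenvector (n : nat) (e : nat -> H) (x : H) : Prop :=
  (forall i, (i < n)%nat -> inner x (e i) = 0) /\ norm x = 1 /\
  exists m, G x = scal m x /\
    forall u, (forall i, (i < n)%nat -> inner u (e i) = 0) -> norm (G u) <= Rabs m * norm u.

(** The orthogonal complement of the vectors already found is closed, invariant under [G] by
    symmetry, and nonzero by infinite dimension: a vector outside their span minus its projection
    lies in it. *)
Lemma next_eigenvector_exists n (e : nat -> H) :
  (forall i, (i < n)%nat -> next_eigenvector i e (e i)) ->
  exists x, next_eigenvector n e x.
Proof.
  intros He.
  assert (ortho : forall i j, (i < n)%nat -> (j < n)%nat ->
    inner (e i) (e j) = if Nat.eqb i j then 1 else 0).
  { intros i j Hi Hj. destruct (Nat.eqb_spec i j) as [->|D].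
    - rewrite inner_norm. rewrite (proj1 (proj2 (He j Hj))). ring.
    - destruct (Nat.lt_total i j) as [I|[I|I]]; [|contradiction|].
      + rewrite inner_sym. apply (He j Hj). exact I.
      + apply (He i Hi). exact I. }
  assert (nz : exists u0 : H, (forall i, (i < n)%nat -> inner u0 (e i) = 0) /\ u0 <> zero).
  (* [sum_n _ n] has n + 1 terms, so the empty family is not an instance of [infinite_dimensional];
     for n = 0 the family consisting of the zero vector takes its place. *)
  { destruct n as [|n].
    - destruct (H_inf 0%nat (fun _ => zero)) as [u Hu]. exists u. split; [lia|].
      intros Z. apply (Hu (fun _ => 0)). rewrite sum_O Z. vec. ring.
    - destruct (H_inf n e) as [u Hu].
      exists (minus u (sum_n (fun i => scal (inner u (e i)) (e i)) n)). split.
      + intros i Hi. rewrite inner_minus inner_sum_n.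
        rewrite (sum_n_ext_loc _ (fun j => if Nat.eqb j i then inner u (e i) else 0)).
        * enough (S : forall N, sum_n (fun j => if Nat.eqb j i then inner u (e i) else 0) N =
            if Nat.leb i N then inner u (e i) else 0).
          { rewrite S. destruct (Nat.leb_spec i n); [ring|lia]. }
          induction N as [|N IH].
          -- rewrite sum_O. destruct i; reflexivity.
          -- rewrite sum_Sn IH. unfold plus; cbn -[Nat.eqb Nat.leb].
             destruct (Nat.leb_spec i N), (Nat.eqb_spec (S N) i),
               (Nat.leb_spec i (S N)); try lia; ring.
        * intros j Hj. rewrite inner_scal ortho; try lia.
          destruct (Nat.eqb_spec j i) as [->|]; ring_R.
      + intros Z. apply (Hu (fun i => inner u (e i))).
        apply (plus_reg_r (G := H) (opp (sum_n (fun i => scal (inner u (e i)) (e i)) n))).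
        etransitivity; [exact Z|]. symmetry. apply (plus_opp_r (G := H)). }
  destruct nz as (u0 & Vu0 & u0n).
  destruct (exists_eigenvector (fun u => forall i, (i < n)%nat -> inner u (e i) = 0) u0)
    as (x & m & Vx & Nx & Gx & B).
  - intros u v Vu Vv i Hi. rewrite inner_plus Vu ?Vv //. ring.
  - intros a u Vu i Hi. rewrite inner_scal Vu //. ring.
  - intros y u Vy L i Hi.
    apply (filterlim_locally_unique (F := eventually) (V := R_NormedModule)
      (fun k => inner (y k) (e i))).
    + apply filterlim_inner. exact L.
    + apply filterlim_ext with (fun _ => 0); [|apply filterlim_const].
      intros k. symmetry. apply Vy. exact Hi.
  - intros u Vu i Hi. destruct (He i Hi) as (_ & _ & m & Gm & _).
    rewrite G_sym Gm inner_scal_r Vu //. ring.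
  - exact Vu0.
  - exact u0n.
  - exists x. split; [exact Vx|]. split; [exact Nx|]. exists m. auto.
Qed.

(** Each choice depends on all earlier ones, so the recursion carries the whole initial segment.
    [epsilon] keeps it total; that the choices succeed is proved afterwards by strong induction. *)
Fixpoint eigen_prefix (n : nat) : nat -> H :=
  match n with
  | O => fun _ => zero
  | S k => fun i =>
      if Nat.eqb i k
      then epsilon (inhabits zero) (next_eigenvector k (eigen_prefix k))
      else eigen_prefix k i
  end.

Lemma eigen_sequence : exists e : nat -> H, forall n, next_eigenvector n e (e n).
Proof.
  set (e := fun n => eigen_prefix (S n) n). exists e.
  assert (P : forall n i, (i < n)%nat -> eigen_prefix n i = e i).
  { induction n as [|n IH]; intros i Hi; [lia|].
    simpl. destruct (Nat.eqb_spec i n) as [->|D].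
    - unfold e. simpl. rewrite Nat.eqb_refl. reflexivity.
    - apply IH. lia. }
  assert (ext : forall n f g x, (forall i, (i < n)%nat -> f i = g i) ->
    next_eigenvector n f x -> next_eigenvector n g x).
  { intros n f g x E (A1 & A2 & m & A3 & A4). repeat split; [|assumption|].
    - intros i Hi. rewrite -E //. apply A1, Hi.
    - exists m. split; [assumption|]. intros u Hu. apply A4. intros i Hi.
      rewrite E //. apply Hu, Hi. }
  intros n; induction n as [n IH] using (well_founded_induction Wf_nat.lt_wf).
  apply ext with (eigen_prefix n); [intros; apply P; assumption|].
  unfold e. simpl. rewrite Nat.eqb_refl. apply epsilon_spec.
  apply next_eigenvector_exists. intros i Hi.
  rewrite P //. apply ext with e; [intros; symmetry; apply P; lia|]. apply IH, Hi.
Qed.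

(** For completeness, let [v] be the sum of the expansion of [u]. Then u - v is orthogonal to every
    e_i, so |G (u - v)| <= |m_N| |u - v| for each N by maximality. Since m_N tends to 0, G (u - v) =
    0, and injectivity gives u = v. *)
Theorem compact_symmetric_eigenbasis : exists (e : nat -> H) (m : nat -> R),
  (forall i j, inner (e i) (e j) = if Nat.eqb i j then 1 else 0) /\
  (forall n, G (e n) = scal (m n) (e n)) /\
  (forall u, is_series (fun n => scal (inner u (e n)) (e n)) u).
Proof.
  destruct eigen_sequence as [e He]. exists e.
  set (m := fun n => proj1_sig (constructive_indefinite_description _ (proj2 (proj2 (He n))))).
  assert (Hm : forall n, G (e n) = scal (m n) (e n) /\
    forall u, (forall i, (i < n)%nat -> inner u (e i) = 0) -> norm (G u) <= Rabs (m n) * norm u).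
  { intros n. exact (proj2_sig (constructive_indefinite_description _ (proj2 (proj2 (He n))))). }
  exists m.
  assert (ortho : forall i j, inner (e i) (e j) = if Nat.eqb i j then 1 else 0).
  { intros i j. destruct (Nat.eqb_spec i j) as [->|D].
    - rewrite inner_norm. rewrite (proj1 (proj2 (He j))). ring.
    - destruct (Nat.lt_total i j) as [I|[I|I]]; [|contradiction|].
      + rewrite inner_sym. apply (He j). exact I.
      + apply (He i). exact I. }
  split; [exact ortho|]. split; [intros n; apply Hm|]. intros u.
  destruct (riesz_fischer e ortho (fun i => inner u (e i)) (norm u ^ 2)) as [v Hv].
  { intros N. apply bessel, ortho. }
  enough (E : G (minus u v) = zero).
  { apply G_injective in E.
    assert (D : u = v) by (apply norm_minus_eq0; rewrite E; apply (norm_zero (V := H))).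
    rewrite -D in Hv. exact Hv. }
  apply (norm_eq_zero (V := H)). apply Rle_antisym; [|apply norm_ge_0].
  apply le_epsilon. intros eps eps0.
  pose proof (norm_ge_0 (minus u v)) as P.
  destruct (eigenvalues_tend_to_0 e m (eps / (norm (minus u v) + 1)) ortho) as [N HN].
  - intros n. apply Hm.
  - apply Rdiv_lt_0_compat; lra.
  - eapply Rle_trans.
    + apply (proj2 (Hm N)). intros i _. rewrite inner_minus.
      rewrite (inner_series e ortho _ v i Hv). ring.
    + pose proof (HN N (Nat.le_refl N)) as I.
      apply Rle_trans with (eps / (norm (minus u v) + 1) * norm (minus u v)); [nra|].
      rewrite Rplus_0_l.
      apply Rle_trans with (eps / (norm (minus u v) + 1) * (norm (minus u v) + 1)).
      * apply Rmult_le_compat_l; [|lra]. left. apply Rdiv_lt_0_compat; lra.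
      * right. field. lra.
Qed.

End CompactSymmetric.

(** * Spectral calculus of the operator *)

Section Resolvent.

Context {H : HilbertSpace}.

Variables (A : operator H) (l : R) (G : H -> H).
Hypothesis A_sa : self_adjoint A.
Hypothesis A_res : is_resolvent A (fun _ => True) l G.

Lemma self_adjoint_sym x y : dom A x -> dom A y -> inner (app A x) y = inner x (app A y).
Proof.
  intros Dx Dy. destruct A_sa as (_ & _ & S). apply (S y (app A y)); auto.
Qed.

Lemma resolvent_left u : dom A u -> G (minus (app A u) (scal l u)) = u.
Proof. destruct A_res as (_ & R2 & _). intros D. apply R2; auto. Qed.

Lemma resolvent_dom u : dom A (G u).
Proof. destruct A_res as (R1 & _ & _). apply R1; exact I. Qed.

Lemma resolvent_right u : minus (app A (G u)) (scal l (G u)) = u.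
Proof. destruct A_res as (R1 & _ & _). apply R1; exact I. Qed.

(** [is_resolvent] does not postulate linearity; it is inherited from [A], the inverse of a linear
    bijection being linear. *)
Lemma resolvent_plus u v : G (plus u v) = plus (G u) (G v).
Proof.
  destruct A_sa as ((_ & Lp & _) & _).
  destruct (Lp (G u) (G v)) as [D E]; [apply resolvent_dom..|].
  rewrite -(resolvent_left _ D) E. f_equal.
  rewrite -{1}(resolvent_right u) -{1}(resolvent_right v). vec. ring.
Qed.

Lemma resolvent_scal (a : R) u : G (scal a u) = scal a (G u).
Proof.
  destruct A_sa as ((_ & _ & Ls) & _).
  destruct (Ls a (G u)) as [D E]; [apply resolvent_dom|].
  rewrite -(resolvent_left _ D) E. f_equal.
  rewrite -{1}(resolvent_right u). vec. ring.
Qed.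

Lemma resolvent_sym u v : inner (G u) v = inner u (G v).
Proof.
  rewrite -{1}(resolvent_right v) -{2}(resolvent_right u).
  rewrite inner_minus inner_minus_r inner_scal inner_scal_r self_adjoint_sym //;
    apply resolvent_dom.
Qed.

Lemma resolvent_injective u : G u = zero -> u = zero.
Proof.
  intros E. destruct A_sa as ((D0 & _ & Ls) & _).
  rewrite -(resolvent_right u) E.
  destruct (Ls 0 zero D0) as [_ E0].
  assert (Z : scal 0 (zero : H) = zero) by (vec; ring).
  rewrite Z in E0. rewrite E0. vec. ring.
Qed.

Lemma resolvent_bounded : exists C, forall u, norm (G u) <= C * norm u.
Proof. destruct A_res as (_ & _ & C & HC). exists C. intros u. apply HC. exact I. Qed.

Lemma eigenvector_of_resolvent (x : H) (m : R) : norm x = 1 -> G x = scal m x ->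
  dom A x /\ app A x = scal (l + / m) x.
Proof.
  intros N E.
  assert (m0 : m <> 0).
  { intros ->. assert (Z : x = zero).
    { apply resolvent_injective. rewrite E. vec. ring. }
    rewrite Z (norm_zero (V := H)) in N. lra. }
  destruct A_sa as ((_ & _ & Ls) & _).
  assert (Ex : scal (/ m) (G x) = x) by (rewrite E; vec; field; exact m0).
  destruct (Ls (/ m) (G x) (resolvent_dom x)) as [D E2].
  rewrite Ex in D, E2. split; [exact D|]. rewrite E2.
  assert (E3 : app A (G x) = plus x (scal (l * m) x)).
  { rewrite -{2}(resolvent_right x) E. vec. ring. }
  rewrite E3. vec. field. exact m0.
Qed.

(** The basis picked by [epsilon] need not be the one built from the resolvent. This converse
    transfers compactness of the resolvent to the eigenvalues of any eigenbasis. *)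
Lemma resolvent_eigenvector (x : H) (lam : R) : norm x = 1 -> dom A x ->
  app A x = scal lam x -> lam <> l /\ G x = scal (/ (lam - l)) x.
Proof.
  intros N D E.
  assert (X : scal (lam - l) (G x) = x).
  { rewrite -resolvent_scal -{2}(resolvent_left x D) E. f_equal. vec. ring. }
  assert (lam <> l).
  { intros ->. assert (Z : x = zero) by (rewrite -X; vec; ring).
    rewrite Z (norm_zero (V := H)) in N. lra. }
  split; [assumption|]. rewrite -{2}X. vec. field. lra.
Qed.

End Resolvent.

(** * Coordinates in the eigenbasis and functions of the operator *)

Section Eigenbasis.

Context {H : HilbertSpace}.

Variable A : operator H.
Hypothesis H_inf : infinite_dimensional H.
Hypothesis A_sa : self_adjoint A.
Hypothesis A_nonneg : nonnegative A.
Hypothesis A_cr : compact_resolvent A.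

Notation e := (fst (eigenbasis A)).
Notation lam := (snd (eigenbasis A)).

Lemma eigenbasis_spec : is_eigenbasis A (eigenbasis A).
Proof.
  unfold eigenbasis. apply epsilon_spec.
  destruct A_cr as (l & G & GR & Gc).
  destruct (compact_symmetric_eigenbasis G) as (e & m & ortho & eig & basis).
  - apply (resolvent_plus A l); assumption.
  - apply (resolvent_scal A l); assumption.
  - apply (resolvent_bounded A l); assumption.
  - apply (resolvent_sym A l); assumption.
  - assumption.
  - apply (resolvent_injective A l); assumption.
  - assumption.
  - exists (e, fun n => l + / m n). split; [exact ortho|]. split; [|exact basis].
    intros n. apply (eigenvector_of_resolvent A l G); auto.
    apply Rle_antisym.
    + apply norm_le_of_inner; [lra|]. rewrite ortho Nat.eqb_refl. lra.
    + apply Rle_of_sqr; [apply norm_ge_0|]. rewrite -inner_norm ortho Nat.eqb_refl. lra.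
Qed.

Lemma eigenbasis_ortho i j : inner (e i) (e j) = if Nat.eqb i j then 1 else 0.
Proof. apply eigenbasis_spec. Qed.

Lemma eigenbasis_norm n : norm (e n) = 1.
Proof.
  apply Rle_antisym.
  - apply norm_le_of_inner; [lra|]. rewrite eigenbasis_ortho Nat.eqb_refl. lra.
  - apply Rle_of_sqr; [apply norm_ge_0|].
    rewrite -inner_norm eigenbasis_ortho Nat.eqb_refl. lra.
Qed.

Lemma eigenbasis_dom n : dom A (e n).
Proof. apply eigenbasis_spec. Qed.

Lemma eigenbasis_app n : app A (e n) = scal (lam n) (e n).
Proof. apply eigenbasis_spec. Qed.

Lemma eigenbasis_series u : is_series (fun n => scal (inner u (e n)) (e n)) u.
Proof. apply eigenbasis_spec. Qed.

Lemma eigenvalue_ge0 n : 0 <= lam n.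
Proof.
  pose proof (A_nonneg (e n) (eigenbasis_dom n)) as P.
  rewrite eigenbasis_app inner_scal eigenbasis_ortho Nat.eqb_refl in P. lra.
Qed.

Lemma eigenvalues_tend_to_infinity (c : R) :
  exists N, forall n, (N <= n)%nat -> c < lam n.
Proof.
  destruct A_cr as (l & G & GR & Gc).
  assert (eig : forall n, lam n <> l /\ G (e n) = scal (/ (lam n - l)) (e n)).
  { intros n. apply (resolvent_eigenvector A l G); auto using eigenbasis_norm, eigenbasis_dom.
    apply eigenbasis_app. }
  pose proof (Rabs_pos c). pose proof (Rabs_pos l).
  pose proof (Rle_abs c). pose proof (Rle_abs l). pose proof (Rle_abs (- l)) as Il.
  rewrite Rabs_Ropp in Il.
  (* With this threshold |lam n - l| > |c| + |l| + 1 for large n. As lam n >= 0, the difference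
     cannot be that negative, so lam n > c. *)
  destruct (eigenvalues_tend_to_0 G Gc e (fun n => / (lam n - l)) (/ (Rabs c + Rabs l + 1)))
    as [N HN].
  - apply eigenbasis_ortho.
  - intros n. apply eig.
  - apply Rinv_0_lt_compat. lra.
  - exists N. intros n Hn. pose proof (HN n Hn) as I.
    destruct (eig n) as [D _]. pose proof (eigenvalue_ge0 n).
    assert (P : 0 < Rabs (lam n - l)) by (apply Rabs_pos_lt; lra).
    rewrite Rabs_inv in I. apply Rinv_lt_cancel in I; [|assumption].
    unfold Rabs in I at 3; destruct (Rcase_abs (lam n - l)); lra.
Qed.

Lemma parseval u v : is_series (fun n => inner u (e n) * inner v (e n)) (inner u v).
Proof.
  pose proof (filterlim_inner eventually _ u v (eigenbasis_series u)) as L.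
  eapply filterlim_ext; [|exact L]. intros N. simpl.
  rewrite inner_sum_n. apply sum_n_ext. intros n.
  rewrite inner_scal (inner_sym _ (e n)). reflexivity.
Qed.

Lemma eq_of_coords u v : (forall n, inner u (e n) = inner v (e n)) -> u = v.
Proof.
  intros E. apply eq_of_inner. intros w.
  rewrite -(is_series_unique _ _ (parseval u w)) -(is_series_unique _ _ (parseval v w)).
  apply Series_ext. intros n. rewrite E. reflexivity.
Qed.

Lemma norm_le_of_coords u C : 0 <= C ->
  (forall N, sum_n (fun n => inner u (e n) ^ 2) N <= C ^ 2) -> norm u <= C.
Proof.
  intros C0 B. apply (norm_series_le e eigenbasis_ortho (fun n => inner u (e n)));
    [assumption..|apply eigenbasis_series].
Qed.

Lemma app_coord u n : dom A u -> inner (app A u) (e n) = lam n * inner u (e n).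
Proof.
  intros D. rewrite (self_adjoint_sym A) ?eigenbasis_app ?inner_scal_r //.
  apply eigenbasis_dom.
Qed.

(** A self-adjoint operator equals its adjoint, so membership in the domain may be tested against
    all [x] in [dom A]; Parseval reduces that test to coordinates. *)
Lemma dom_of_coords u v : (forall n, inner v (e n) = lam n * inner u (e n)) ->
  dom A u /\ app A u = v.
Proof.
  intros E. apply A_sa. intros x D.
  rewrite -(is_series_unique _ _ (parseval (app A x) u)).
  rewrite -(is_series_unique _ _ (parseval x v)).
  apply Series_ext. intros n. rewrite E app_coord //. ring.
Qed.

(** The [iota] in [fun_calc] is meaningful once the series converges. A bound for [f] on the
    eigenvalues suffices, by Bessel and Riesz-Fischer; for the semigroup this is where t >= 0 and
    nonnegativity of [A] enter. *)
Lemma fun_calc_coord_bounded f C u :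
  (forall n, Rabs (f (lam n)) <= C) ->
  (forall k, inner (fun_calc A f u) (e k) = f (lam k) * inner u (e k)) /\
  norm (fun_calc A f u) <= C * norm u.
Proof.
  intros B.
  assert (C0 : 0 <= C) by (eapply Rle_trans; [apply Rabs_pos|apply (B 0%nat)]).
  assert (BN : forall N, sum_n (fun n => (f (lam n) * inner u (e n)) ^ 2) N <= (C * norm u) ^ 2).
  { intros N. apply Rle_trans with (sum_n (fun n => mult (C ^ 2) (inner u (e n) ^ 2)) N).
    - apply sum_n_le. intros n. unfold mult; simpl. rewrite !Rmult_1_r.
      pose proof (B n) as I.
      assert (f (lam n) * f (lam n) <= C * C).
      { rewrite -(Rabs_pos_eq (f (lam n) * f (lam n))); [|nra].
        rewrite Rabs_mult. pose proof (Rabs_pos (f (lam n))).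
        apply Rmult_le_compat; auto. }
      pose proof (pow2_ge_0 (inner u (e n))). nra.
    - rewrite (sum_n_mult_l (K := R_Ring)). rewrite Rpow_mult_distr.
      apply Rmult_le_compat_l; [apply pow2_ge_0|]. apply bessel, eigenbasis_ortho. }
  assert (S : is_series (fun n => scal (f (lam n) * inner u (e n)) (e n)) (fun_calc A f u)).
  { unfold fun_calc. apply iota_correct.
    destruct (riesz_fischer e eigenbasis_ortho _ _ BN) as [v Hv].
    exists v. split; [exact Hv|]. intros w Hw.
    exact (filterlim_locally_unique (F := eventually) (V := H) _ _ _ Hv Hw). }
  split.
  - intros k. exact (inner_series e eigenbasis_ortho _ _ k S).
  - apply (norm_series_le e eigenbasis_ortho _ _ _) with (2 := BN) (3 := S).
    apply Rmult_le_pos; [assumption|apply norm_ge_0].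
Qed.

Lemma semigroup_coord t u n : 0 <= t ->
  inner (semigroup A t u) (e n) = exp (- t * lam n) * inner u (e n).
Proof.
  intros Ht. apply (fun_calc_coord_bounded (fun l => exp (- t * l)) 1). intros k.
  rewrite Rabs_pos_eq; [|left; apply exp_pos].
  rewrite -exp_0. pose proof (eigenvalue_ge0 k).
  destruct (Req_dec (t * lam k) 0) as [E|E].
  - right. f_equal. lra.
  - left. apply exp_increasing. nra.
Qed.

(** * The spectral cut-off and the lower edge of the high spectrum *)

Section Cutoff.

Variables mu eps : R.

Lemma P_coord u n : inner (P_ A mu eps u) (e n) =
  if Rle_dec (lam n) (Lambda mu eps) then inner u (e n) else 0.
Proof.
  unfold P_. rewrite (proj1 (fun_calc_coord_bounded _ 1 u _)); last first.
  - intros k. unfold indicator_Icc.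
    destruct (Rle_dec 0 (lam k)); [destruct (Rle_dec (lam k) (Lambda mu eps))|];
      rewrite ?Rabs_R0 ?Rabs_R1; lra.
  - unfold indicator_Icc. destruct (Rle_dec 0 (lam n)) as [_|N].
    + destruct (Rle_dec (lam n) (Lambda mu eps)); ring.
    + exfalso. apply N, eigenvalue_ge0.
Qed.

Lemma Q_coord u n : inner (Q_ A mu eps u) (e n) =
  if Rle_dec (lam n) (Lambda mu eps) then 0 else inner u (e n).
Proof.
  unfold Q_. rewrite inner_minus P_coord.
  destruct (Rle_dec (lam n) (Lambda mu eps)); ring.
Qed.

Lemma range_P u : range (P_ A mu eps) u <->
  forall n, Lambda mu eps < lam n -> inner u (e n) = 0.
Proof.
  split.
  - intros [w ->] n I. rewrite P_coord. destruct (Rle_dec (lam n) (Lambda mu eps)); lra.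
  - intros Z. exists u. apply eq_of_coords. intros n. rewrite P_coord.
    destruct (Rle_dec (lam n) (Lambda mu eps)); [reflexivity|]. apply Z. lra.
Qed.

Lemma range_Q u : range (Q_ A mu eps) u <->
  forall n, lam n <= Lambda mu eps -> inner u (e n) = 0.
Proof.
  split.
  - intros [w ->] n I. rewrite Q_coord. destruct (Rle_dec (lam n) (Lambda mu eps)); lra.
  - intros Z. exists u. apply eq_of_coords. intros n. rewrite Q_coord.
    destruct (Rle_dec (lam n) (Lambda mu eps)); [|reflexivity]. apply Z. assumption.
Qed.

(** On the range of the projection [A] agrees with f(A) for the truncation f(l) = l on [0, Lambda]
    and 0 elsewhere, which is bounded. *)
Lemma range_P_dom u : range (P_ A mu eps) u -> dom A u.
Proof.
  intros Ru. rewrite range_P in Ru.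
  set (f := fun l => l * indicator_Icc 0 (Lambda mu eps) l).
  assert (B : forall n, Rabs (f (lam n)) <= Rabs (Lambda mu eps)).
  { intros n. unfold f, indicator_Icc. pose proof (Rabs_pos (Lambda mu eps)).
    destruct (Rle_dec 0 (lam n)); [destruct (Rle_dec (lam n) (Lambda mu eps))|];
      rewrite ?Rmult_0_r ?Rmult_1_r ?Rabs_R0 //.
    rewrite !Rabs_pos_eq //; lra. }
  apply (dom_of_coords u (fun_calc A f u)). intros n.
  rewrite (proj1 (fun_calc_coord_bounded f _ u B)). unfold f, indicator_Icc.
  pose proof (eigenvalue_ge0 n).
  destruct (Rle_dec 0 (lam n)); [destruct (Rle_dec (lam n) (Lambda mu eps))|]; try lra.
  rewrite (Ru n); lra.
Qed.

(** Since [A] minus the eigenvalue kills [e n], a resolvent would send zero to [e n]. The norm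
    bound, rather than linearity, excludes this. *)
Lemma eigenvalue_in_spectrum n : Lambda mu eps < lam n ->
  spectrum A (range (Q_ A mu eps)) (lam n).
Proof.
  intros I (G & _ & R2 & C & HC).
  assert (Qe : range (Q_ A mu eps) (e n)).
  { apply range_Q. intros k Hk. rewrite eigenbasis_ortho.
    destruct (Nat.eqb_spec n k) as [->|]; [lra|reflexivity]. }
  assert (Qz : range (Q_ A mu eps) zero) by (apply range_Q; intros; apply inner_zero).
  pose proof (R2 _ Qe (eigenbasis_dom n)) as E.
  rewrite eigenbasis_app (_ : minus _ _ = zero) in E; [|vec; ring].
  pose proof (HC _ Qz) as B. rewrite E eigenbasis_norm (norm_zero (V := H)) in B. lra.
Qed.

(** Below Lambda the resolvent on the range of Q is explicit: g(A) with g(x) = 1/(x - l) above the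
    cut-off, bounded by 1/(Lambda - l). The value 0 below the cut-off keeps g(A) inside that
    range. *)
Lemma spectrum_lower_bound l : spectrum A (range (Q_ A mu eps)) l -> Lambda mu eps <= l.
Proof.
  intros S. apply Rnot_lt_le. intros I. apply S.
  set (g := fun x => if Rle_dec x (Lambda mu eps) then 0 else / (x - l)).
  assert (B : forall n, Rabs (g (lam n)) <= / (Lambda mu eps - l)).
  { intros n. unfold g. destruct (Rle_dec (lam n) (Lambda mu eps)).
    - rewrite Rabs_R0. left. apply Rinv_0_lt_compat. lra.
    - rewrite Rabs_pos_eq; [|left; apply Rinv_0_lt_compat; lra].
      apply Rinv_le_contravar; lra. }
  assert (gc : forall u n, inner (fun_calc A g u) (e n) = g (lam n) * inner u (e n))
    by (intros u; apply (fun_calc_coord_bounded g _ u B)).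
  assert (R : forall u, range (Q_ A mu eps) u ->
    dom A (fun_calc A g u) /\ app A (fun_calc A g u) = plus u (scal l (fun_calc A g u))).
  { intros u Qu. rewrite range_Q in Qu. apply dom_of_coords. intros n.
    rewrite inner_plus inner_scal gc. unfold g.
    destruct (Rle_dec (lam n) (Lambda mu eps)) as [J|J].
    - rewrite Qu //. ring.
    - field. lra. }
  exists (fun_calc A g). split; [|split].
  - intros u Qu. destruct (R u Qu) as [D E]. split; [|split; [exact D|]].
    + apply range_Q. intros n J. rewrite gc. unfold g.
      destruct (Rle_dec (lam n) (Lambda mu eps)); [ring|contradiction].
    + rewrite E. vec. ring.
  - intros u Qu D. rewrite range_Q in Qu. apply eq_of_coords. intros n.
    rewrite gc inner_minus inner_scal app_coord //. unfold g.
    destruct (Rle_dec (lam n) (Lambda mu eps)) as [J|J].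
    + rewrite Qu //. ring.
    + field. lra.
  - exists (/ (Lambda mu eps - l)). intros u _. apply (fun_calc_coord_bounded g _ u B).
Qed.

(** The eigenvalues are unbounded, so the high spectrum is nonempty; it is also bounded below. Hence
    the infimum is finite and [real] does not return its default 0. *)
Lemma lambda_plus_bounds : Lambda mu eps <= lambda_plus A mu eps /\
  forall n, Lambda mu eps < lam n -> lambda_plus A mu eps <= lam n.
Proof.
  unfold lambda_plus.
  destruct (Glb_Rbar_correct (spectrum A (range (Q_ A mu eps)))) as [lb glb].
  destruct (eigenvalues_tend_to_infinity (Lambda mu eps)) as [N HN].
  pose proof (lb _ (eigenvalue_in_spectrum N (HN N (Nat.le_refl N)))) as I1.
  pose proof (glb (Lambda mu eps) (fun x Hx => spectrum_lower_bound x Hx)) as I2.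
  destruct (Glb_Rbar _) as [g| |]; simpl in *; try contradiction.
  split; [exact I2|]. intros n Hn. exact (lb _ (eigenvalue_in_spectrum n Hn)).
Qed.

End Cutoff.

End Eigenbasis.

(** * Energy estimates *)

Notation at_half_line t := (within (fun s => 0 <= s) (locally t)).

(** Solutions are continuous only on the half line, while the mean value theorem and differentiation
    of integrals use two-sided continuity; extending by the value at 0 bridges the gap. *)
Lemma continuous_clamp {U : UniformSpace} (f : R -> U) t :
  filterlim f (at_half_line (Rmax 0 t)) (locally (f (Rmax 0 t))) ->
  continuous (fun s => f (Rmax 0 s)) t.
Proof.
  intros C. apply (filterlim_comp _ _ _ (Rmax 0) f _ (at_half_line (Rmax 0 t))); [|exact C].
  assert (L : filterlim (Rmax 0) (locally t) (locally (Rmax 0 t))).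
  { apply filterlim_locally. intros eps. exists eps. intros s Hs.
    unfold ball in *; simpl in *. unfold AbsRing_ball, abs, minus, plus, opp in *; simpl in *.
    revert Hs. unfold Rmax. destruct (Rle_dec 0 s), (Rle_dec 0 t);
      unfold Rabs; repeat destruct Rcase_abs; lra. }
  intros P HP. apply (L (fun x => 0 <= x -> P x)) in HP. unfold filtermap in *.
  eapply filter_imp; [|exact HP]. intros s Hs. apply Hs, Rmax_l.
Qed.

(** The function exp(-c s) (f s + k) is nonincreasing. The signs of [c] and [k] are left free: both
    are negative for the decay of the high modes, and [c] is positive for the growth of the low-mode
    error. *)
Lemma gronwall (f df : R -> R) (c k t : R) : 0 <= t ->
  filterlim f (at_half_line 0) (locally (f 0)) ->
  (forall s, 0 < s -> is_derive f s (df s)) ->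
  (forall s, 0 < s -> df s <= c * (f s + k)) ->
  f t + k <= exp (c * t) * (f 0 + k).
Proof.
  intros Ht C D I.
  set (g := fun s => exp (- c * s) * (f (Rmax 0 s) + k)).
  (* [df] is only controlled inside the half line. *)
  set (dg := fun s => if Rlt_dec 0 s then exp (- c * s) * (df s - c * (f s + k)) else 0).
  destruct (MVT_gen g 0 t dg) as (x & _ & E).
  - rewrite Rmin_left // Rmax_right //. intros x [Hx _].
    unfold dg. destruct (Rlt_dec 0 x); [|contradiction].
    apply is_derive_ext_loc with (fun s => exp (- c * s) * (f s + k)).
    + exists (mkposreal x Hx). intros y Hy. unfold g. rewrite Rmax_right //.
      unfold ball in Hy; simpl in Hy. unfold AbsRing_ball, abs, minus, plus, opp in Hy; simpl in Hy.
      apply Rabs_lt_between in Hy. lra.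
    + pose proof (D x Hx) as Dx. auto_derive.
      * exists (df x). exact Dx.
      * rewrite (is_derive_unique (fun s => f s) _ _ Dx). ring.
  - intros x Hx. rewrite Rmin_left // in Hx. apply continuity_pt_filterlim.
    apply (continuous_mult (K := R_AbsRing)).
    + apply (ex_derive_continuous (fun s => exp (- c * s))). auto_derive. exact Logic.I.
    + apply (continuous_plus (V := R_NormedModule)); [|apply continuous_const].
      apply continuous_clamp.
      destruct (Req_dec x 0) as [->|N].
      * rewrite Rmax_left //; lra.
      * rewrite Rmax_right; [|lra]. eapply filterlim_filter_le_1; [apply filter_le_within|].
        apply (ex_derive_continuous f). exists (df x). apply D. lra.
  - assert (Hdg : dg x <= 0).
    { unfold dg. destruct (Rlt_dec 0 x) as [P|P]; [|lra].
      pose proof (I x P). pose proof (exp_pos (- c * x)). nra. }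
    unfold g in E. rewrite Rmax_right // Rmax_left in E; [|lra].
    rewrite Rmult_0_r exp_0 in E.
    assert (B : exp (- c * t) * (f t + k) <= f 0 + k) by nra.
    apply Rmult_le_compat_l with (r := exp (c * t)) in B; [|left; apply exp_pos].
    rewrite -Rmult_assoc -exp_plus (_ : c * t + - c * t = 0) ?exp_0 in B; [lra|ring].
Qed.

Section Energy.

Variables (N : nat) (z g : nat -> R -> R) (l : nat -> R) (c k : R).
Hypothesis z_cont : forall n, filterlim (z n) (at_half_line 0) (locally (z n 0)).
Hypothesis z_0 : forall n, z n 0 = 0.
Hypothesis z_derive : forall n s, 0 < s -> is_derive (z n) s (g n s - l n * z n s).

Lemma energy_bound t : 0 <= t ->
  (forall s, 0 < s -> sum_n (fun n => 2 * z n s * (g n s - l n * z n s)) N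
     <= c * (sum_n (fun n => z n s ^ 2) N + k)) ->
  sum_n (fun n => z n t ^ 2) N <= (exp (c * t) - 1) * k.
Proof.
  intros Ht I.
  pose proof (gronwall (fun s => sum_n (fun n => z n s ^ 2) N)
    (fun s => sum_n (fun n => 2 * z n s * (g n s - l n * z n s)) N) c k t Ht) as W.
  cbv beta in W.
  assert (Z : sum_n (fun n => z n 0 ^ 2) N = 0).
  { rewrite (sum_n_ext _ (fun _ => 0)); [|intros n; rewrite z_0; exact (Rmult_0_l _)].
    rewrite sum_n_const. ring_R. }
  rewrite {2}Z in W.
  enough (sum_n (fun n => z n t ^ 2) N + k <= exp (c * t) * (0 + k)) by lra.
  apply W.
  - assert (sqr : forall n, filterlim (fun s => z n s ^ 2) (at_half_line 0) (locally (z n 0 ^ 2))).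
    { intros n. apply (filterlim_comp _ _ _ (z n) (fun x => x ^ 2) _ (locally (z n 0)));
        [apply z_cont|].
      apply (ex_derive_continuous (fun x => x ^ 2)). auto_derive. exact Logic.I. }
    clear - sqr. induction N as [|M IH].
    + rewrite sum_O. apply (filterlim_ext (fun s => z 0%nat s ^ 2)).
      { intros s. rewrite sum_O. reflexivity. }
      apply sqr.
    + rewrite sum_Sn. apply (filterlim_ext (fun s =>
        plus (sum_n (fun n => z n s ^ 2) M) (z (S M) s ^ 2))).
      { intros s. rewrite sum_Sn. reflexivity. }
      eapply filterlim_comp_2; [exact IH|exact (sqr (S M))|].
      apply (filterlim_plus (V := R_NormedModule)).
  - intros s Hs. apply (is_derive_sum_n (fun n s => z n s ^ 2)). intros n _.
    pose proof (z_derive n s Hs) as Dz. auto_derive.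
    + exists (g n s - l n * z n s). exact Dz.
    + rewrite (is_derive_unique (fun s => z n s) _ _ Dz). ring.
  - exact I.
Qed.

End Energy.

(** * Mild solutions *)

Lemma Riemann_sum_inner {H : HilbertSpace} (f : R -> H) (v : H) (ptd : SF_seq) :
  inner (Riemann_sum f ptd) v = Riemann_sum (fun s => inner (f s) v) ptd.
Proof.
  apply (SF_cons_ind (fun ptd =>
    inner (Riemann_sum f ptd) v = Riemann_sum (fun s => inner (f s) v) ptd)).
  - intros x. apply inner_zero.
  - intros h s IH. rewrite !Riemann_sum_cons inner_plus inner_scal IH. reflexivity.
Qed.

Lemma is_RInt_inner {H : HilbertSpace} (f : R -> H) (v : H) (a b : R) (J : H) :
  is_RInt f a b J -> is_RInt (fun s => inner (f s) v) a b (inner J v).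
Proof.
  intros I. pose proof (filterlim_inner _ _ _ v I) as L.
  eapply filterlim_ext; [|exact L]. intros ptd. simpl.
  rewrite inner_scal Riemann_sum_inner. reflexivity.
Qed.

Lemma filterlim_lipschitz {H : HilbertSpace} {T} (E : (T -> Prop) -> Prop) {FE : Filter E}
    (F : H -> H) (L : R) (f : T -> H) (x : H) :
  (forall u w, norm (minus (F u) (F w)) <= L * norm (minus u w)) ->
  filterlim f E (locally x) -> filterlim (fun t => F (f t)) E (locally (F x)).
Proof.
  intros Lip C. apply filterlim_norm_minus; [exact FE|]. intros eps.
  pose proof (Rabs_pos L). pose proof (cond_pos eps). pose proof (Rle_abs L).
  assert (P : 0 < eps / (Rabs L + 1)) by (apply Rdiv_lt_0_compat; lra).
  pose proof (proj1 (filterlim_norm_minus E f x) C (mkposreal _ P)) as B. simpl in B.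
  eapply filter_imp; [|exact B]. intros t Bt. cbv beta in Bt.
  pose proof (norm_ge_0 (minus (f t) x)).
  eapply Rle_lt_trans; [apply Lip|].
  apply Rle_lt_trans with ((Rabs L + 1) * norm (minus (f t) x)); [nra|].
  apply Rlt_le_trans with ((Rabs L + 1) * (eps / (Rabs L + 1))).
  - apply Rmult_lt_compat_l; [lra|exact Bt].
  - right. field. lra.
Qed.

Section MildSolutions.

Context {H : HilbertSpace}.

Variable A : operator H.
Hypothesis H_inf : infinite_dimensional H.
Hypothesis A_sa : self_adjoint A.
Hypothesis A_nonneg : nonnegative A.
Hypothesis A_cr : compact_resolvent A.

Notation e := (fst (eigenbasis A)).
Notation lam := (snd (eigenbasis A)).

Variables (F : H -> H) (M L : R).
Hypothesis F_bounded : forall u, norm (F u) <= M.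
Hypothesis F_lip : forall u w, norm (minus (F u) (F w)) <= L * norm (minus u w).

Variables (u0 : H) (v : R -> H).
Hypothesis v_mild : mild_solution A F u0 v.

Lemma mild_initial : v 0 = u0.
Proof.
  destruct v_mild as [_ I]. specialize (I 0 (Rle_refl 0)).
  assert (E : minus (v 0) (semigroup A 0 u0) = zero).
  { exact (filterlim_locally_unique (V := H) _ _ _ I (is_RInt_point _ 0)). }
  apply (eq_of_coords A); auto. intros n.
  assert (E2 : inner (minus (v 0) (semigroup A 0 u0)) (e n) = 0) by (rewrite E; apply inner_zero).
  rewrite inner_minus semigroup_coord // in E2; [|lra].
  rewrite Ropp_0 Rmult_0_l exp_0 in E2. lra.
Qed.

Lemma mild_coord_continuous n t : 0 <= t ->
  filterlim (fun s => inner (v s) (e n)) (at_half_line t) (locally (inner (v t) (e n))).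
Proof. intros Ht. apply filterlim_inner. apply v_mild. exact Ht. Qed.

(** The integrating factor exp(t lam) removes the dependence of the Duhamel kernel on its upper
    limit. What remains is the primitive [W] of a continuous scalar function, to which the
    fundamental theorem of calculus applies. *)
Lemma mild_coord_derive n t : 0 < t ->
  is_derive (fun s => inner (v s) (e n)) t
    (inner (F (v t)) (e n) - lam n * inner (v t) (e n)).
Proof.
  intros Ht.
  set (f := fun s => inner (F (v (Rmax 0 s))) (e n)).
  set (W := fun s => exp (s * lam n) * inner (v s) (e n) - inner u0 (e n)).
  assert (f_cont : forall s, continuous f s).
  { intros s. apply (continuous_clamp (fun s => inner (F (v s)) (e n))).
    apply filterlim_inner. apply (filterlim_lipschitz _ _ L); [exact F_lip|].
    apply v_mild. apply Rmax_l. }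
  assert (W_int : forall s, 0 <= s -> is_RInt (fun r => exp (r * lam n) * f r) 0 s (W s)).
  { intros s Hs.
    pose proof (is_RInt_inner _ (e n) _ _ _ (proj2 v_mild s Hs)) as I.
    apply (is_RInt_scal (V := R_NormedModule) _ _ _ (exp (s * lam n))) in I.
    rewrite inner_minus semigroup_coord // in I.
    assert (E : scal (exp (s * lam n))
      (inner (v s) (e n) - exp (- s * lam n) * inner u0 (e n)) = W s).
    { unfold W, scal; simpl. unfold mult; simpl.
      rewrite Rmult_minus_distr_l -Rmult_assoc -exp_plus.
      rewrite (_ : s * lam n + - s * lam n = 0); [|ring]. rewrite exp_0. ring. }
    rewrite E in I. eapply is_RInt_ext; [|exact I].
    rewrite Rmin_left // Rmax_right //. intros r Hr. cbv beta.
    rewrite semigroup_coord //; [|lra]. unfold f. rewrite Rmax_right; [|lra].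
    unfold scal; simpl. unfold mult; simpl. rewrite -Rmult_assoc -exp_plus.
    f_equal. f_equal. ring. }
  assert (W_derive : is_derive W t (exp (t * lam n) * f t)).
  { apply (is_derive_RInt (V := R_NormedModule) (fun r => exp (r * lam n) * f r) W 0).
    - exists (mkposreal t Ht). intros s Hs. apply W_int.
      unfold ball in Hs; simpl in Hs. unfold AbsRing_ball, abs, minus, plus, opp in Hs; simpl in Hs.
      apply Rabs_lt_between in Hs. lra.
    - apply (continuous_mult (K := R_AbsRing)); [|apply f_cont].
      apply (ex_derive_continuous (fun r => exp (r * lam n))). auto_derive. exact Logic.I. }
  apply is_derive_ext with (fun s => exp (- (s * lam n)) * (W s + inner u0 (e n))).
  { intros s. unfold W.
    rewrite (_ : forall a b c : R, a * (b * c - inner u0 (e n) + inner u0 (e n)) = a * b * c);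
      [|intros; ring].
    rewrite -exp_plus Rplus_opp_l exp_0. apply Rmult_1_l. }
  assert (Ef : f t = inner (F (v t)) (e n)) by (unfold f; rewrite Rmax_right //; lra).
  auto_derive.
  - exists (exp (t * lam n) * f t). exact W_derive.
  - rewrite (is_derive_unique (fun s => W s) _ _ W_derive) Ef. unfold W.
    assert (X : exp (- (t * lam n)) * exp (t * lam n) = 1)
      by (rewrite -exp_plus Rplus_opp_l; apply exp_0).
    transitivity (exp (- (t * lam n)) * exp (t * lam n) *
      (inner (F (v t)) (e n) - lam n * inner (v t) (e n))); [ring|].
    rewrite X. ring.
Qed.

Variables mu eps : R.
Hypothesis mu_pos : 0 < mu.
Hypothesis eps_pos : 0 < eps.

Lemma Lambda_pos : 0 < Lambda mu eps.
Proof. apply Rdiv_lt_0_compat; [assumption|]. apply pow_lt. assumption. Qed.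

(** Let E be a partial sum of squared high coordinates after removal of the free evolution, so that
    E(0) = 0. With lp the lower edge of the high spectrum, E' <= -lp E + M^2/lp = -lp (E -
    (M/lp)^2), whence E <= (M/lp)^2 uniformly in time and in the number of terms. This dictates the
    arguments -lp and -(M/lp)^2 of [energy_bound]. *)
Lemma Q_duhamel_bound t : 0 <= t ->
  norm (Q_ A mu eps (minus (v t) (semigroup A t u0))) <= M / lambda_plus A mu eps.
Proof.
  intros Ht.
  destruct (lambda_plus_bounds A) with (mu := mu) (eps := eps) as [B1 B2]; auto.
  pose proof Lambda_pos as B0.
  set (lp := lambda_plus A mu eps) in *.
  assert (M0 : 0 <= M) by exact (Rle_trans _ _ _ (norm_ge_0 (F u0)) (F_bounded u0)).
  set (chi := fun n => if Rle_dec (lam n) (Lambda mu eps) then 0 else 1).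
  apply (norm_le_of_coords A); auto.
  { apply Rdiv_le_0_compat; lra. }
  intros N.
  set (z := fun n s => chi n * (inner (v s) (e n) - exp (- s * lam n) * inner u0 (e n))).
  rewrite (sum_n_ext _ (fun n => z n t ^ 2)); last first.
  { intros n. rewrite Q_coord // inner_minus semigroup_coord //. unfold z, chi.
    destruct (Rle_dec (lam n) (Lambda mu eps)); ring_R. }
  eapply Rle_trans.
  - apply (energy_bound N z (fun n s => chi n * inner (F (v s)) (e n)) lam
      (- lp) (- (M / lp) ^ 2)).
    + intros n.
      apply (filterlim_comp _ _ _ (fun s => inner (v s) (e n) - exp (- s * lam n) * inner u0 (e n))
        (fun x => chi n * x) _
        (locally (inner (v 0) (e n) - exp (- 0 * lam n) * inner u0 (e n)))).
      * apply (filterlim_comp_2 (fun s => inner (v s) (e n))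
          (fun s => - (exp (- s * lam n) * inner u0 (e n))) Rplus
          (H := locally (- (exp (- 0 * lam n) * inner u0 (e n))))
          (mild_coord_continuous n 0 (Rle_refl 0))).
        -- eapply filterlim_filter_le_1; [apply filter_le_within|].
           apply (ex_derive_continuous (fun s => - (exp (- s * lam n) * inner u0 (e n)))).
           auto_derive. exact Logic.I.
        -- apply (filterlim_plus (V := R_NormedModule)).
      * apply (ex_derive_continuous (fun x => chi n * x)). auto_derive. exact Logic.I.
    + intros n. unfold z. rewrite mild_initial Ropp_0 Rmult_0_l exp_0. ring.
    + intros n s Hs. pose proof (mild_coord_derive n s Hs) as D.
      assert (X : forall (q : R -> R) (dq a : R), is_derive q s dq ->
        is_derive (fun s => chi n * (q s - exp (- s * lam n) * a)) s
          (chi n * (dq + lam n * exp (- s * lam n) * a))).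
      { intros q dq a Dq. auto_derive.
        - exists dq. exact Dq.
        - rewrite (is_derive_unique (fun s => q s) _ _ Dq). ring. }
      eapply is_derive_ext; [reflexivity|].
      rewrite (_ : chi n * inner (F (v s)) (e n) - lam n * z n s =
        chi n * (inner (F (v s)) (e n) - lam n * inner (v s) (e n) +
          lam n * exp (- s * lam n) * inner u0 (e n))); [|unfold z; ring].
      exact (X _ _ _ D).
    + exact Ht.
    + intros s Hs.
      apply Rle_trans with (sum_n (fun n => plus (mult (- lp) (z n s ^ 2))
        (mult (/ lp) (inner (F (v s)) (e n) ^ 2))) N).
      * apply sum_n_le. intros n. unfold plus, mult; simpl. rewrite !Rmult_1_r.
        set (f := inner (F (v s)) (e n)).
        (* Young's inequality 2 z f <= lp z^2 + f^2/lp spends half of the dissipation 2 lp z^2 on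
           the forcing and leaves the rate lp. *)
        assert (X : 0 <= lp * (z n s - / lp * f) ^ 2)
          by (apply Rmult_le_pos; [lra|apply pow2_ge_0]).
        replace (lp * (z n s - / lp * f) ^ 2)
          with (lp * (z n s * z n s) - 2 * z n s * f + / lp * (f * f)) in X by (field; lra).
        destruct (Rle_dec (lam n) (Lambda mu eps)) as [J|J] eqn:EJ.
        -- assert (Z0 : z n s = 0) by (unfold z, chi; rewrite EJ; ring).
           assert (C0 : chi n = 0) by (unfold chi; rewrite EJ; reflexivity).
           rewrite Z0 in X. rewrite Z0. lra.
        -- assert (C1 : chi n = 1) by (unfold chi; rewrite EJ; reflexivity).
           rewrite C1. pose proof (B2 n ltac:(lra)). pose proof (pow2_ge_0 (z n s)). nra.
      * rewrite sum_n_plus !(sum_n_mult_l (K := R_Ring)). unfold plus, mult; simpl.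
        assert (X : sum_n (fun n => inner (F (v s)) (e n) ^ 2) N <= M ^ 2).
        { eapply Rle_trans; [apply bessel, eigenbasis_ortho; auto|].
          apply pow_incr. split; [apply norm_ge_0|apply F_bounded]. }
        apply Rmult_le_compat_l with (r := / lp) in X; [|left; apply Rinv_0_lt_compat; lra].
        rewrite Rmult_plus_distr_l.
        rewrite (_ : - lp * - (M / lp * (M / lp * 1)) = / lp * M ^ 2); [|field; lra].
        apply Rplus_le_compat_l. exact X.
  - pose proof (exp_pos (- lp * t)). pose proof (pow2_ge_0 (M / lp)). nra.
Qed.

Lemma Q_semigroup_bound t : 0 <= t ->
  norm (Q_ A mu eps (semigroup A t u0)) <= exp (- t * lambda_plus A mu eps) * norm u0.
Proof.
  intros Ht.
  destruct (lambda_plus_bounds A) with (mu := mu) (eps := eps) as [B1 B2]; auto.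
  set (lp := lambda_plus A mu eps) in *.
  pose proof (exp_pos (- t * lp)) as E0.
  apply (norm_le_of_coords A); auto.
  { apply Rmult_le_pos; [lra|apply norm_ge_0]. }
  intros N.
  apply Rle_trans with (sum_n (fun n => mult (exp (- t * lp) ^ 2) (inner u0 (e n) ^ 2)) N).
  - apply sum_n_le. intros n. rewrite Q_coord // semigroup_coord //.
    unfold mult; simpl. rewrite !Rmult_1_r.
    pose proof (pow2_ge_0 (inner u0 (e n))).
    destruct (Rle_dec (lam n) (Lambda mu eps)) as [J|J]; [nra|].
    pose proof (B2 n ltac:(lra)) as I.
    assert (exp (- t * lam n) <= exp (- t * lp)).
    { destruct (Req_dec (t * lam n) (t * lp)) as [Q|Q].
      - right. f_equal. lra.
      - left. apply exp_increasing. nra. }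
    pose proof (exp_pos (- t * lam n)).
    assert (exp (- t * lam n) * exp (- t * lam n) <= exp (- t * lp) * exp (- t * lp)) by nra.
    nra.
  - rewrite (sum_n_mult_l (K := R_Ring)) Rpow_mult_distr.
    apply Rmult_le_compat_l; [apply pow2_ge_0|]. apply bessel, eigenbasis_ortho; auto.
Qed.

Lemma Q_mild_bound t : 0 <= t ->
  norm (Q_ A mu eps (v t)) <=
    exp (- t * lambda_plus A mu eps) * norm u0 + M / lambda_plus A mu eps.
Proof.
  intros Ht.
  rewrite (_ : Q_ A mu eps (v t) = plus (Q_ A mu eps (semigroup A t u0))
    (Q_ A mu eps (minus (v t) (semigroup A t u0)))).
  - eapply Rle_trans; [apply (norm_triangle (V := H))|].
    apply Rplus_le_compat; [apply Q_semigroup_bound|apply Q_duhamel_bound]; exact Ht.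
  - apply (eq_of_coords A); auto. intros n. rewrite inner_plus !Q_coord // inner_minus.
    destruct (Rle_dec (lam n) (Lambda mu eps)); ring.
Qed.

End MildSolutions.

(** * Reduced dynamics *)

Lemma is_derive_inner {H : HilbertSpace} (p : R -> H) (v : H) (t : R) (dp : H) :
  is_derive p t dp -> is_derive (fun s => inner (p s) v) t (inner dp v).
Proof.
  intros D.
  pose proof (filterdiff_comp' (V := H) (W := R_NormedModule) p (fun u : H => inner u v) t
    (fun y => scal y dp) (fun u : H => inner u v) D
    (filterdiff_linear (V := R_NormedModule) (fun u : H => inner u v) (is_linear_inner v))) as C.
  eapply filterdiff_ext_lin; [exact C|]. intros y. apply inner_scal.
Qed.

Lemma sum_n_le_of_support (a : nat -> R) N M :
  (forall n, 0 <= a n) -> (forall n, (N < n)%nat -> a n = 0) -> sum_n a M <= sum_n a N.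
Proof.
  intros P Z.
  assert (up : forall k j, sum_n a k <= sum_n a (k + j)).
  { intros k j. induction j as [|j IH].
    - rewrite Nat.add_0_r. apply Rle_refl.
    - rewrite Nat.add_succ_r sum_Sn. unfold plus; simpl.
      pose proof (P (S (k + j))). lra. }
  destruct (Nat.le_gt_cases M N) as [I|I].
  - replace N with (M + (N - M))%nat by lia. apply up.
  - right. replace M with (N + (M - N))%nat by lia.
    induction (M - N)%nat as [|j IH].
    + rewrite Nat.add_0_r. reflexivity.
    + rewrite Nat.add_succ_r sum_Sn IH Z; [|lia]. apply Rplus_0_r.
Qed.

Section ReducedDynamics.

Context {H : HilbertSpace}.

Variable A : operator H.
Hypothesis H_inf : infinite_dimensional H.
Hypothesis A_sa : self_adjoint A.
Hypothesis A_nonneg : nonnegative A.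
Hypothesis A_cr : compact_resolvent A.

Notation e := (fst (eigenbasis A)).
Notation lam := (snd (eigenbasis A)).

Variables (F : H -> H) (L : R).
Hypothesis L_pos : 0 < L.
Hypothesis F_lip : forall u w, norm (minus (F u) (F w)) <= L * norm (minus u w).

Variables mu eps : R.
Notation P := (P_ A mu eps).
Notation Q := (Q_ A mu eps).

Variables (u0 : H) (v : R -> H).
Hypothesis v_mild : mild_solution A F u0 v.

Variables (h : H -> H) (p : R -> H) (tau delta : R).
Hypothesis tau_ge0 : 0 <= tau.
Hypothesis p_0 : p 0 = P (v tau).
Hypothesis p_cont : continuous_on_half_line p.
Hypothesis p_range : forall t, 0 <= t -> range P (p t).
Hypothesis p_derive : forall t, 0 < t ->
  is_derive p t (minus (P (F (plus (p t) (h (p t))))) (app A (p t))).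
Hypothesis delta_bound : forall t, 0 <= t ->
  norm (h (p t)) + norm (Q (v (tau + t))) <= delta.

Lemma plus_P_Q u : plus (P u) (Q u) = u.
Proof. unfold Q_. vec. ring. Qed.

Lemma shifted_coord_continuous n :
  filterlim (fun s => inner (v (tau + s)) (e n)) (at_half_line 0)
    (locally (inner (v (tau + 0)) (e n))).
Proof.
  apply (filterlim_comp _ _ _ (Rplus tau) (fun s => inner (v s) (e n)) _ (at_half_line (tau + 0))).
  - intros U HU.
    assert (C : filterlim (Rplus tau) (locally 0) (locally (tau + 0))).
    { apply (ex_derive_continuous (fun s => tau + s)). auto_derive. exact Logic.I. }
    apply C in HU. unfold filtermap, within in *. eapply filter_imp; [|exact HU].
    intros s Hs Hs0. apply Hs. lra.
  - apply (mild_coord_continuous A F u0); [assumption|lra].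
Qed.

(** Let E be the squared norm of the low-mode difference. Young's inequality with weight [L] gives
    E' <= L E + |D|^2/L, the dissipation being dropped, and |D|^2 <= 2 L^2 (E + delta^2). So E' <= 4
    L (E + delta^2), the 4 leaving some room, and the square root turns the rate 4 L into 2 L. *)
Lemma reduced_error t : 0 <= t ->
  norm (minus (p t) (P (v (tau + t)))) <= exp (2 * L * t) * delta.
Proof.
  intros Ht.
  assert (delta0 : 0 <= delta).
  { eapply Rle_trans; [|apply (delta_bound 0 (Rle_refl 0))].
    apply Rplus_le_le_0_compat; apply norm_ge_0. }
  (* Beyond [N] every mode is high, so the partial sum up to [N] already controls the full norm of
     the low-mode difference, and the differential inequality closes on itself. *)
  destruct (eigenvalues_tend_to_infinity A) with (c := Lambda mu eps) as [N HN]; auto.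
  set (chi := fun n => if Rle_dec (lam n) (Lambda mu eps) then 1 else 0).
  set (z := fun n s => chi n * (inner (p s) (e n) - inner (v (tau + s)) (e n))).
  set (D := fun s => minus (F (plus (p s) (h (p s)))) (F (v (tau + s)))).
  assert (z_coord : forall n s, 0 <= s ->
    inner (minus (p s) (P (v (tau + s)))) (e n) = z n s).
  { intros n s Hs. rewrite inner_minus P_coord //. unfold z, chi.
    destruct (Rle_dec (lam n) (Lambda mu eps)) as [J|J]; [ring|].
    rewrite (proj1 (range_P A H_inf A_sa A_nonneg A_cr mu eps (p s)) (p_range s Hs)); lra. }
  assert (z_norm : forall s, 0 <= s ->
    norm (minus (p s) (P (v (tau + s)))) ^ 2 <= sum_n (fun n => z n s ^ 2) N).
  { intros s Hs.
    assert (Z : 0 <= sum_n (fun n => z n s ^ 2) N)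
      by (apply sum_n_nonneg; intros; apply pow2_ge_0).
    rewrite -(pow2_sqrt _ Z). apply pow_incr. split; [apply norm_ge_0|].
    apply (norm_le_of_coords A); auto; [apply sqrt_pos|]. intros K.
    rewrite pow2_sqrt //. rewrite (sum_n_ext _ (fun n => z n s ^ 2)).
    - apply sum_n_le_of_support; [intros; apply pow2_ge_0|].
      intros n Hn. unfold z, chi. destruct (Rle_dec (lam n) (Lambda mu eps)) as [J|J]; [|ring].
      pose proof (HN n ltac:(lia)). lra.
    - intros n. rewrite z_coord //. }
  assert (D_norm : forall s, 0 <= s ->
    norm (D s) ^ 2 <= L ^ 2 * (2 * (sum_n (fun n => z n s ^ 2) N + delta ^ 2))).
  { intros s Hs. pose proof (z_norm s Hs) as Z.
    set (y := norm (minus (p s) (P (v (tau + s))))) in *.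
    assert (B : norm (D s) <= L * (y + delta)).
    { eapply Rle_trans; [apply F_lip|]. apply Rmult_le_compat_l; [lra|].
      rewrite (_ : minus (plus (p s) (h (p s))) (v (tau + s)) =
        plus (minus (p s) (P (v (tau + s)))) (minus (h (p s)) (Q (v (tau + s))))); last first.
      { rewrite -{1}(plus_P_Q (v (tau + s))). vec. ring. }
      eapply Rle_trans; [apply (norm_triangle (V := H))|]. apply Rplus_le_compat_l.
      eapply Rle_trans; [apply (norm_triangle (V := H))|]. rewrite (norm_opp (V := H)).
      apply delta_bound. exact Hs. }
    assert (B2 : norm (D s) ^ 2 <= (L * (y + delta)) ^ 2)
      by (apply pow_incr; split; [apply norm_ge_0|exact B]).
    eapply Rle_trans; [exact B2|]. rewrite Rpow_mult_distr.
    apply Rmult_le_compat_l; [apply pow2_ge_0|].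
    pose proof (pow2_ge_0 (y - delta)). nra. }
  apply Rle_of_sqr; [apply Rmult_le_pos; [left; apply exp_pos|assumption]|].
  eapply Rle_trans; [apply z_norm, Ht|].
  apply Rle_trans with ((exp (4 * L * t) - 1) * delta ^ 2).
  - apply (energy_bound N z (fun n s => chi n * inner (D s) (e n)) lam (4 * L) (delta ^ 2)).
    + intros n.
      apply (filterlim_comp _ _ _ (fun s => inner (p s) (e n) - inner (v (tau + s)) (e n))
        (fun x => chi n * x) _ (locally (inner (p 0) (e n) - inner (v (tau + 0)) (e n)))).
      * apply (filterlim_comp_2 (fun s => inner (p s) (e n)) (fun s => - inner (v (tau + s)) (e n))
          Rplus (G := locally (inner (p 0) (e n))) (H := locally (- inner (v (tau + 0)) (e n)))).
        -- apply filterlim_inner. apply p_cont. lra.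
        -- apply (filterlim_comp _ _ _ (fun s => inner (v (tau + s)) (e n)) Ropp _ _ _
             (shifted_coord_continuous n)).
           apply (filterlim_opp (V := R_NormedModule)).
        -- apply (filterlim_plus (V := R_NormedModule)).
      * apply (ex_derive_continuous (fun x => chi n * x)). auto_derive. exact Logic.I.
    + intros n. unfold z. rewrite p_0 P_coord // Rplus_0_r. unfold chi.
      destruct (Rle_dec (lam n) (Lambda mu eps)); ring.
    + intros n s Hs.
      pose proof (is_derive_inner _ (e n) _ _ (p_derive s Hs)) as Dp.
      pose proof (mild_coord_derive A H_inf A_sa A_nonneg A_cr F L F_lip u0 v v_mild n
        (tau + s) ltac:(lra)) as Dv.
      assert (X : forall (q w : R -> R) (dq dw : R), is_derive q s dq -> is_derive w (tau + s) dw ->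
        is_derive (fun s => chi n * (q s - w (tau + s))) s (chi n * (dq - dw))).
      { intros q w dq dw Dq Dw. auto_derive.
        - split; [exists dq; exact Dq|]. split; [exists dw; exact Dw|exact Logic.I].
        - rewrite (is_derive_unique (fun s => q s) _ _ Dq) (is_derive_unique (fun s => w s) _ _ Dw).
          ring. }
      pose proof (X _ _ _ _ Dp Dv) as Dz.
      rewrite inner_minus P_coord // app_coord // in Dz;
        [|apply (range_P_dom A) with (mu := mu) (eps := eps); auto; apply p_range; lra].
      rewrite (_ : chi n * inner (D s) (e n) - lam n * z n s = chi n *
        ((if Rle_dec (lam n) (Lambda mu eps) then inner (F (plus (p s) (h (p s)))) (e n) else 0) -
          lam n * inner (p s) (e n) -
          (inner (F (v (tau + s))) (e n) - lam n * inner (v (tau + s)) (e n)))); [exact Dz|].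
      unfold D. rewrite inner_minus. unfold z, chi.
      destruct (Rle_dec (lam n) (Lambda mu eps)); ring.
    + exact Ht.
    + intros s Hs.
      apply Rle_trans with (sum_n (fun n => plus (mult L (z n s ^ 2))
        (mult (/ L) (inner (D s) (e n) ^ 2))) N).
      * apply sum_n_le. intros n. unfold plus, mult; simpl. rewrite !Rmult_1_r.
        set (f := inner (D s) (e n)).
        assert (X : 0 <= L * (z n s - / L * f) ^ 2)
          by (apply Rmult_le_pos; [lra|apply pow2_ge_0]).
        replace (L * (z n s - / L * f) ^ 2)
          with (L * (z n s * z n s) - 2 * z n s * f + / L * (f * f)) in X by (field; lra).
        pose proof (eigenvalue_ge0 A H_inf A_sa A_nonneg A_cr n) as l0.
        assert (Y : 0 <= lam n * (z n s * z n s))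
          by (apply Rmult_le_pos; [exact l0|pose proof (pow2_ge_0 (z n s)); lra]).
        (* [chi n] is 0 or 1 and is already a factor of [z n s], so the cut-off of the forcing is
           absorbed. *)
        assert (C : z n s * chi n = z n s)
          by (unfold z, chi; destruct (Rle_dec (lam n) (Lambda mu eps)); ring).
        replace (2 * z n s * (chi n * f - lam n * z n s))
          with (2 * (z n s * chi n) * f - 2 * (lam n * (z n s * z n s))) by ring.
        rewrite C. lra.
      * rewrite sum_n_plus !(sum_n_mult_l (K := R_Ring)).
        set (E := sum_n (fun n => z n s ^ 2) N).
        change (L * E + / L * sum_n (fun n => inner (D s) (e n) ^ 2) N <=
          4 * L * (E + delta ^ 2)).
        assert (E0 : 0 <= E) by (apply sum_n_nonneg; intros; apply pow2_ge_0).
        assert (X : sum_n (fun n => inner (D s) (e n) ^ 2) N <= L ^ 2 * (2 * (E + delta ^ 2))).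
        { eapply Rle_trans; [apply bessel, eigenbasis_ortho; auto|]. apply D_norm. lra. }
        apply Rmult_le_compat_l with (r := / L) in X; [|left; apply Rinv_0_lt_compat; lra].
        rewrite (_ : / L * (L ^ 2 * (2 * (E + delta ^ 2))) = 2 * L * (E + delta ^ 2)) in X;
          [|field; lra].
        assert (0 <= L * (E + delta ^ 2))
          by (apply Rmult_le_pos; [lra|pose proof (pow2_ge_0 delta); lra]).
        assert (0 <= L * delta ^ 2) by (apply Rmult_le_pos; [lra|apply pow2_ge_0]).
        apply Rle_trans with (L * E + 2 * L * (E + delta ^ 2)).
        -- apply Rplus_le_compat_l. exact X.
        -- lra.
  - rewrite Rpow_mult_distr (_ : exp (2 * L * t) ^ 2 = exp (4 * L * t)).
    + pose proof (pow2_ge_0 delta). nra.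
    + simpl. rewrite Rmult_1_r -exp_plus. f_equal. ring.
Qed.

End ReducedDynamics.

(** * From single trajectories to the supremum over the bounded set *)

Lemma norm_le_sup_norm {H : HilbertSpace} (B : H -> Prop) (u : H) :
  bounded_set B -> B u -> norm u <= sup_norm B.
Proof.
  intros [r Hr] Bu. unfold sup_norm.
  destruct (Lub_Rbar_correct (fun x => exists u, B u /\ x = norm u)) as [ub lub].
  assert (I1 := ub (norm u) (ex_intro _ u (conj Bu eq_refl))).
  assert (I2 := lub r).
  destruct (Lub_Rbar _) as [g| |]; simpl in *; [exact I1| |contradiction].
  exfalso. apply I2. intros x (w & Bw & ->). apply Hr, Bw.
Qed.

Theorem theorem4p8
  (H : HilbertSpace) (H_inf : infinite_dimensional H)
  (A : operator H)
  (A_sa : self_adjoint A) (A_nonneg : nonnegative A)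
  (A_cr : compact_resolvent A)
  (F : H -> H) (M L : R) (M_pos : 0 < M) (L_pos : 0 < L)
  (F_bounded : forall u, norm (F u) <= M)
  (F_lip : forall u w, norm (minus (F u) (F w)) <= L * norm (minus u w))
  (mu : R) (mu_pos : 0 < mu)
  (S : R -> H -> H) (S_mild : mild_semiflow A F S)
  (Seps : R -> R -> H -> H)
  (Seps_mild : forall eps, 0 < eps <= 1 ->
     mild_semiflow (A_ A mu eps) F (Seps eps))
  (h : R -> H -> H)
  (h_inertial : forall eps, 0 < eps <= 1 -> 8 * L <= gamma_ A mu eps ->
     is_inertial_manifold A F M L mu eps (Seps eps) (h eps))
  (T kappa : R) (T_pos : 0 < T) (kappa_pos : 0 < kappa) :
  exists C_T eps0 : R, 0 < C_T /\ 0 < eps0 <= 1 /\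
    forall B : H -> Prop, bounded_set B ->
      (forall eps, 0 < eps < eps0 ->
         tau_ kappa mu eps < T -> 8 * L <= gamma_ A mu eps ->
         Rbar_le
           (Lub_Rbar (fun r => exists u0 t,
              B u0 /\ tau_ kappa mu eps <= t <= T /\
              r = norm (minus
                    (Seps eps (t - tau_ kappa mu eps)
                       (R_ A mu eps (h eps) (S (tau_ kappa mu eps) u0)))
                    (S t u0))))
           (Finite (C_T * (sup_norm B * Rpower eps kappa + d_ A M mu eps)))) /\
      (2 <= kappa ->
         exists K eps1 : R, 0 < eps1 <= 1 /\
           forall eps, 0 < eps < eps1 ->
             Rabs (C_T * (sup_norm B * Rpower eps kappa + d_ A M mu eps))
               <= K * eps ^ 2).
Proof.
  pose proof (exp_pos (2 * L * T)) as E0.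
  (* The 1 pays for the components along Q, bounded directly by [delta], and the exponential for the
     low-mode difference over a time at most [T]. Smallness of [eps] beyond eps < 1 is carried by
     the two conditions on [tau_] and [gamma_]. *)
  exists (1 + exp (2 * L * T)), 1. split; [lra|]. split; [lra|].
  assert (bounds : forall eps, 0 < eps < 1 ->
    0 < mu / eps ^ 2 /\ mu / eps ^ 2 <= lambda_plus A mu eps /\ 0 < / eps).
  { intros eps [e0 _]. split; [apply (Lambda_pos mu eps); assumption|].
    split; [|apply Rinv_0_lt_compat; assumption].
    apply (lambda_plus_bounds A); assumption. }
  intros B B_bdd. split.
  - intros eps [e0 e1] tau_lt gam.
    destruct (bounds eps (conj e0 e1)) as (b0 & b1 & b2).
    set (tau := tau_ kappa mu eps) in *. set (lp := lambda_plus A mu eps) in *.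
    assert (ln_neg : ln eps < 0) by (rewrite -ln_1; apply ln_increasing; lra).
    assert (tauE : tau = kappa / mu * eps ^ 2 * - ln eps)
      by (unfold tau, tau_; rewrite Rabs_left //).
    assert (tau0 : 0 <= tau).
    { rewrite tauE. apply Rmult_le_pos; [|lra].
      apply Rmult_le_pos; [left; apply Rdiv_lt_0_compat; lra|apply pow2_ge_0]. }
    (* The delay is calibrated so that tau * mu / eps^2 = -kappa ln eps, and the lower edge of the
       high spectrum is at least mu / eps^2. *)
    assert (decay : forall s, 0 <= s -> exp (- (tau + s) * lp) <= Rpower eps kappa).
    { intros s Hs. unfold Rpower.
      assert (I : - (tau + s) * lp <= kappa * ln eps).
      { apply Rle_trans with (- tau * (mu / eps ^ 2)).
        - assert (tau * (mu / eps ^ 2) <= tau * lp) by (apply Rmult_le_compat_l; lra).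
          assert (0 <= s * lp) by (apply Rmult_le_pos; lra). lra.
        - right. rewrite tauE. field. lra. }
      destruct I as [I|I]; [left; apply exp_increasing, I|right; f_equal; exact I]. }
    apply (proj2 (Lub_Rbar_correct _)). intros r (u0 & t & Bu & Ht & ->). simpl.
    destruct (h_inertial eps) as (_ & h_bound & _ & _ & red & _); [lra|exact gam|].
    destruct (red (P_ A mu eps (S tau u0))) as (p & p0 & pc & pr & pd).
    { exists (S tau u0). reflexivity. }
    unfold R_. rewrite (proj2 (pr (t - tau) ltac:(lra))).
    (* The two summands of [d_] have separate origins: M over [lambda_plus] is the Duhamel part of Q
       S(t) u0, and M over [alpha_] is the bound on the graph map [h]. *)
    set (delta := sup_norm B * Rpower eps kappa + d_ A M mu eps).
    assert (hQ : forall s, 0 <= s ->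
      norm (h eps (p s)) + norm (Q_ A mu eps (S (tau + s) u0)) <= delta).
    { intros s Hs. pose proof (h_bound (p s) (proj1 (pr s Hs))) as I1.
      pose proof (Q_mild_bound A H_inf A_sa A_nonneg A_cr F M L F_bounded F_lip u0
        (fun t => S t u0) (S_mild u0) mu eps mu_pos e0 (tau + s) ltac:(lra)) as I2.
      fold lp in I2. cbv beta in I2.
      assert (I3 : exp (- (tau + s) * lp) * norm u0 <= Rpower eps kappa * sup_norm B).
      { apply Rmult_le_compat; [left; apply exp_pos|apply norm_ge_0|apply decay, Hs|].
        apply norm_le_sup_norm; assumption. }
      unfold delta, d_. fold lp. lra. }
    pose proof (reduced_error A H_inf A_sa A_nonneg A_cr F L L_pos F_lip mu eps u0
      (fun t => S t u0) (S_mild u0) (h eps) p tau delta tau0 p0 pc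
      (fun s Hs => proj1 (pr s Hs)) pd hQ (t - tau) ltac:(lra)) as err. cbv beta in err.
    pose proof (hQ (t - tau) ltac:(lra)) as rest.
    rewrite (_ : tau + (t - tau) = t) in err, rest; [|ring].
    rewrite (_ : minus (plus (p (t - tau)) (h eps (p (t - tau)))) (S t u0) =
      plus (minus (p (t - tau)) (P_ A mu eps (S t u0)))
        (minus (h eps (p (t - tau))) (Q_ A mu eps (S t u0)))); last first.
    { rewrite -{1}(plus_P_Q A mu eps (S t u0)). vec. ring. }
    eapply Rle_trans; [apply (norm_triangle (V := H))|].
    rewrite Rplus_comm Rmult_plus_distr_r Rmult_1_l. apply Rplus_le_compat.
    + eapply Rle_trans; [apply (norm_triangle (V := H))|]. rewrite (norm_opp (V := H)).
      exact rest.
    + eapply Rle_trans; [exact err|]. apply Rmult_le_compat_r.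
      * eapply Rle_trans; [|exact rest]. apply Rplus_le_le_0_compat; apply norm_ge_0.
      * destruct (Req_dec (t - tau) T) as [->|N]; [right; reflexivity|].
        left. apply exp_increasing. apply Rmult_lt_compat_l; lra.
  (* Both [lambda_plus] and [alpha_] are at least mu / eps^2, so each summand of [d_] is at most (M
     / mu) eps^2, which gives the 2 M / mu; and eps^kappa <= eps^2 because eps < 1. The constant
     depends on [B] through its sup norm, taken in absolute value so that its sign need not be
     discussed. *)
  - intros k2. exists ((1 + exp (2 * L * T)) * (Rabs (sup_norm B) + 2 * M / mu)), 1.
    split; [lra|]. intros eps [e0 e1].
    destruct (bounds eps (conj e0 e1)) as (b0 & b1 & b2).
    assert (M / lambda_plus A mu eps <= M / mu * eps ^ 2 /\
      M / alpha_ A mu eps <= M / mu * eps ^ 2 /\ 0 <= d_ A M mu eps) as (d1 & d2 & d3).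
    { assert (X : forall x, mu / eps ^ 2 <= x -> 0 <= M / x <= M / mu * eps ^ 2).
      { intros x Hx. split; [apply Rdiv_le_0_compat; lra|].
        rewrite (_ : M / mu * eps ^ 2 = M * / (mu / eps ^ 2)); [|field; lra].
        apply Rmult_le_compat_l; [lra|]. apply Rinv_le_contravar; lra. }
      pose proof (X _ b1). assert (Y : mu / eps ^ 2 <= alpha_ A mu eps) by (unfold alpha_; lra).
      apply X in Y. unfold d_. lra. }
    assert (pw : 0 < Rpower eps kappa <= eps ^ 2).
    { split; [apply exp_pos|]. rewrite -(Rpower_pow 2 eps e0). unfold Rpower.
      assert (ln eps < 0) by (rewrite -ln_1; apply ln_increasing; lra).
      change (INR 2) with 2.
      destruct k2 as [k2|<-]; [left; apply exp_increasing; nra|right; reflexivity]. }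
    rewrite Rabs_mult (Rabs_pos_eq (1 + _)); [|lra].
    rewrite (Rmult_assoc (1 + _)). apply Rmult_le_compat_l; [lra|].
    eapply Rle_trans; [apply Rabs_triang|].
    rewrite Rabs_mult (Rabs_pos_eq (d_ _ _ _ _)) // (Rabs_pos_eq (Rpower _ _)); [|lra].
    rewrite Rmult_plus_distr_r. apply Rplus_le_compat.
    + apply Rmult_le_compat_l; [apply Rabs_pos|lra].
    + unfold d_. rewrite (_ : 2 * M / mu * eps ^ 2 = M / mu * eps ^ 2 + M / mu * eps ^ 2);
        [|field; lra]. lra.
Qed.
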